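(* Let $k_1>0$, $k_2>0$, and let $u_0\in H^s(\mathbb{S})$ with $s>5/2$. Put $\mu_0=\int_{\mathbb{S}}u_0\,dx$, $\mu_1=\big(\int_{\mathbb{S}}u_{0,x}^2\,dx\big)^{1/2}$, $m_0=\mu_0-u_{0,xx}$, and $$C_1=\tfrac32k_2-k_1\mu_0,\qquad C_2=k_1\mu_0\mu_1\big(\tfrac{\sqrt3}{3}\mu_0-\mu_1\big)+k_2\mu_1\big(\tfrac{\sqrt3}{3}\mu_0-\tfrac12\mu_1\big).$$ Suppose $C_1\le 0$ and $C_2>0$, and set $b=\sqrt{\frac{1}{2k_2C_2}}$. Let $T^*>0$ be the maximal time of existence of the corresponding strong solution of $$m_t+k_1\big((2\mu(u)u-u_x^2)m\big)_x+k_2(2mu_x+um_x)=0,\qquad m=\mu(u)-u_{xx},\qquad u(0,x)=u_0(x),$$ with $u$ $1$-periodic in $x$. Assume $m_0(x)\ge0$ for all $x\in\mathbb{S}$, that $m_0(x_0)>0$ for some $x_0\in\mathbb{S}$, and that either $$(1)\quad u_{0,x}(x_0)=-\frac{1}{2bk_2},$$ or $$(2)\quad u_{0,x}(x_0)<\min\Big\{-\frac1{2bk_2},\ -\frac{\sqrt{k_2+2k_1m_0(x_0)}}{2b\sqrt{k_2}\,(k_1m_0(x_0)+k_2)}\Big\}.$$ Then the solution blows up at a finite time $T^*\le t^*$, where, with $n_0=\frac{1}{m_0(x_0)}$ and $n_1=2b\big(k_1+\frac{k_2}{m_0(x_0)}\big)u_{0,x}(x_0)$, $$t^*=\begin{cases}\sqrt{\dfrac{1}{2k_2C_2}}\,\ln\Big(\dfrac{k_2}{k_1m_0(x_0)}+1\Big),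 & \text{in case (1)},\\[4mm] \sqrt{\dfrac1{2k_2C_2}}\,\ln\left(\dfrac{\frac{k_1}{k_2}-\sqrt{n_1^2-n_0^2-2\frac{k_1}{k_2}n_0}}{n_0+n_1+\frac{k_1}{k_2}}\right), & \text{in case (2)}.\end{cases}$$
   Context: $\mathbb{S}=\mathbb{R}/\mathbb{Z}$; $\mu(u)=\int_{\mathbb{S}}u(t,x)\,dx$. Strong solution: $u\in C([0,T);H^s)\cap C^1([0,T);H^{s-1})$ satisfying the equation. The quantities $\mu(u(t))=\mu_0$ and $\big(\int_{\mathbb{S}}u_x^2(t,x)\,dx\big)^{1/2}=\mu_1$ are conserved in time. Blowing up at $T^*$ means the maximal existence time $T^*$ is finite. *)

(* Defs.v *)
From HB Require Import structures.
From mathcomp Require Import all_boot all_order all_algebra.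
From mathcomp Require Import all_classical all_reals all_analysis.
Set Implicit Arguments.
Unset Strict Implicit.
Unset Printing Implicit Defensive.
Import Order.TTheory GRing.Theory Num.Theory.
Import numFieldNormedType.Exports.
Local Open Scope ring_scope.
Local Open Scope classical_set_scope.

(* Functions on the circle S = R/Z are represented by 1-periodic functions on
   R, and time-dependent ones by [u : R -> R -> R], with [u t x] = u(t, x). *)

Definition mean (R : realType) (f : R -> R) : R :=
  \int[lebesgue_measure]_(x in `[0, 1]) f x.

(* Real and (up to sign) imaginary part of the n-th Fourier coefficient
   \int_S f(x) exp(- 2 i pi n x) dx of a real-valued f. *)
Definition fourier_cos (R : realType) (f : R -> R) (n : int) : R :=
  mean (fun x => f x * cos (2 * pi * n%:~R * x)).

Definition fourier_sin (R : realType) (f : R -> R) (n : int) : R :=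
  mean (fun x => f x * sin (2 * pi * n%:~R * x)).

(* || (1 - d^2/dx^2)^(s/2) f ||_(L^2(S)), possibly +oo. *)
Definition sobolev_norm (R : realType) (s : R) (f : R -> R) : \bar R :=
  poweR (\esum_(n in [set: int])
           (powR (1 + (2 * pi * n%:~R) ^+ 2) s *
             (fourier_cos f n ^+ 2 + fourier_sin f n ^+ 2))%:E) 2^-1.

(* H^s(S) for s > 1/2 only: every class then has exactly one continuous
   representative, and an element of H^s(S) is identified with it. *)
Definition sobolev (R : realType) (s : R) (f : R -> R) : Prop :=
  [/\ periodic f 1, continuous f & (sobolev_norm s f < +oo)%E].

Definition lifespan (R : realType) (T : \bar R) : set R :=
  [set t | 0 <= t /\ (t%:E < T)%E].

(* u \in C([0, T); H^s) *)
Definition sobolev_continuous (R : realType) (s : R) (T : \bar R)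
    (u : R -> R -> R) : Prop :=
  forall t, lifespan T t ->
    sobolev s (u t) /\
    sobolev_norm s (fun x => u t' x - u t x)
      @[t' --> within (lifespan T) (nbhs t)] --> 0%E.

(* v = u_t as an H^s-valued derivative on [0, T) (one-sided at t = 0) *)
Definition sobolev_derivative (R : realType) (s : R) (T : \bar R)
    (u v : R -> R -> R) : Prop :=
  forall t, lifespan T t ->
    sobolev_norm s (fun x => (t' - t)^-1 * (u t' x - u t x) - v t x)
      @[t' --> within (lifespan T) (t^')] --> 0%E.

Definition momentum (R : realType) (u : R -> R) (x : R) : R :=
  mean u - derive1n 2 u x.

Definition test_function (R : realType) (phi : R -> R) : Prop :=
  periodic phi 1 /\ forall (n : nat) (x : R), derivable (derive1n n phi) x 1.

(* For u(t) \in H^s with s > 5/2, u(t) is of class C^2 and m(t) is continuous,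
   but m_t, m_x are in general only distributions in H^(s-3).  The equation
     m_t + k1 ((2 mu(u) u - u_x^2) m)_x + k2 (2 m u_x + u m_x) = 0
   at a fixed time therefore holds in the sense of distributions on S, with
   u = u(t), v = u_t(t), m_t = mu(v) - v_xx, and the product u m_x defined by
   <u m_x, phi> = <m_x, u phi> = - \int_S m (u phi)_x dx. *)
Definition equation_at (R : realType) (k1 k2 : R) (u v : R -> R) : Prop :=
  let m := momentum u in
  forall phi : R -> R, test_function phi ->
    mean (fun x => mean v * phi x - v x * derive1n 2 phi x)
    - k1 * mean (fun x => (2 * mean u * u x - derive1 u x ^+ 2) * m x * derive1 phi x)
    + k2 * (mean (fun x => 2 * m x * derive1 u x * phi x)
            - mean (fun x => m x * derive1 (fun y => u y * phi y) x)) = 0.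

Definition strong_solution (R : realType) (k1 k2 s : R) (u0 : R -> R)
    (T : \bar R) (u : R -> R -> R) : Prop :=
  u 0 = u0 /\
  exists v : R -> R -> R,
    [/\ sobolev_continuous s T u,
        sobolev_continuous (s - 1) T v,
        sobolev_derivative (s - 1) T u v
      & forall t, lifespan T t -> equation_at k1 k2 (u t) (v t)].

(* u is a strong solution on [0, Tmax) that no strong solution extends past
   Tmax; Tmax = +oo is allowed. *)
Definition maximal_strong_solution (R : realType) (k1 k2 s : R) (u0 : R -> R)
    (Tmax : \bar R) (u : R -> R -> R) : Prop :=
  strong_solution k1 k2 s u0 Tmax u /\
  forall (T : \bar R) (w : R -> R -> R),
    strong_solution k1 k2 s u0 T w ->
    (forall t, lifespan Tmax t -> w t = u t) -> (T <= Tmax)%E.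

(* Main.v *)
Require Import Defs.
From HB Require Import structures.
From mathcomp Require Import all_boot all_order all_algebra.
From mathcomp Require Import all_classical all_reals all_analysis.
From mathcomp Require Import ring lra.
Import Order.TTheory GRing.Theory Num.Theory.
Import numFieldNormedType.Exports.
Local Open Scope ring_scope.
Local Open Scope classical_set_scope.
Set Implicit Arguments.
Unset Strict Implicit.
Unset Printing Implicit Defensive.

(* Write w = u_x and a = k1 (2 mu u - w^2) + k2 u.  Testing the equation against
   cos (2 pi n x) and sin (2 pi n x), and using that a continuous function is
   determined by its Fourier coefficients, gives the classical transport
   equation w_t + a w_x = G with G a polynomial in u, w and the conserved
   quantities mu and mu_1.  Along a characteristic q' = a(t, q) one gets
   w' = G <= C2 - 2 k2 w^2, by the sharp inequality u - mu <= (sqrt 3 / 6) mu_1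
   and C1 <= 0, and the momentum satisfies m' = - 2 w m (k1 m + k2) although m is
   merely continuous.  Hence y = k1 + k2 / m satisfies y' = 2 k2 w y, and
   exp (t / b) (y' - y / b) is nonincreasing, so that
     y <= y(0) cosh (t / b) + b y'(0) sinh (t / b)
   as long as the solution exists.  The right-hand side reaches k1 at t = t*,
   whereas y > k1. *)

(** * Calculus on the real line *)

(** The comparison is linear because of an exact cancellation: from y' = 2 k2 w y and w' <= C2 - 2
    k2 w^2 one gets y'' = 2 k2 (w' + 2 k2 w^2) y <= 2 k2 C2 y, with no term in w left. The constant
    b is the one with 2 k2 C2 b^2 = 1, so this reads y'' <= y / b^2. In X = exp (t / b) the
    resulting bound is a quadratic inequality; with c = 2 b k2 w(0), case (1) is c = -1, where the
    quadratic term disappears, and case (2) has c < -1, where t* comes from the positive root. If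
    Tmax exceeded t*, the inequality at T = t* would be strict at a point of equality. The obstacle
    is regularity: for s > 5/2 the embeddings make u of class C^2 in x but u_t only of class C^1, so
    m need not have classical derivatives. Hence u and u_x are differentiated in time with
    remainders uniform in x, and m only along the flow, as a limit of difference quotients of u_x.
    Every passage from a Sobolev norm to a sup norm rests on absolutely summable Fourier
    coefficients. *)

Section Calculus.
Context {R : realType}.
Implicit Types (f g F G : R -> R) (x y c t : R).

Lemma der_cst c x : is_derive x (1 : R) (fun _ : R => c) 0.
Proof. exact: is_derive_cst. Qed.

Lemma der_id x : is_derive x (1 : R) (fun y : R => y) 1.
Proof. exact: is_derive_id. Qed.

Lemma derD f g x a b : is_derive x (1 : R) f a -> is_derive x (1 : R) g b ->
  is_derive x (1 : R) (fun y => f y + g y) (a + b).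
Proof. by move=> Hf Hg; exact: is_deriveD. Qed.

Lemma derN f x a : is_derive x (1 : R) f a ->
  is_derive x (1 : R) (fun y => - f y) (- a).
Proof. by move=> Hf; exact: is_deriveN. Qed.

Lemma derM f g x a b : is_derive x (1 : R) f a -> is_derive x (1 : R) g b ->
  is_derive x (1 : R) (fun y => f y * g y) (a * g x + f x * b).
Proof.
move=> Hf Hg; have H := is_deriveM Hf Hg.
apply: (is_derive_eq H); by rewrite /GRing.scale /=; ring.
Qed.

Lemma derX2 f x a : is_derive x (1 : R) f a ->
  is_derive x (1 : R) (fun y => f y ^+ 2) (2 * f x * a).
Proof.
move=> Hf; rewrite (_ : (fun y => _) = fun y => f y * f y); last first.
  by apply/funext => y; rewrite expr2.
apply: (is_derive_eq (derM Hf Hf)); ring.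
Qed.

Lemma der_comp f g x a b : is_derive (g x) (1 : R) f a ->
  is_derive x (1 : R) g b -> is_derive x (1 : R) (fun y => f (g y)) (a * b).
Proof.
move=> Hf Hg; exact: (is_derive_eq (is_derive1_comp Hf Hg)).
Qed.

Lemma derV f x a : f x != 0 -> is_derive x (1 : R) f a ->
  is_derive x (1 : R) (fun y => (f y)^-1) (- a / f x ^+ 2).
Proof.
move=> f0 Hf; have H := is_deriveV f0 Hf.
apply: (is_derive_eq H); by rewrite /GRing.scale /=; ring.
Qed.

Lemma der_expR f x a : is_derive x (1 : R) f a ->
  is_derive x (1 : R) (fun y => expR (f y)) (expR (f x) * a).
Proof. by move=> H; apply: der_comp. Qed.

Lemma der_cos f x a : is_derive x (1 : R) f a ->
  is_derive x (1 : R) (fun y => cos (f y)) (- sin (f x) * a).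
Proof. by move=> H; apply: der_comp. Qed.

Lemma der_sin f x a : is_derive x (1 : R) f a ->
  is_derive x (1 : R) (fun y => sin (f y)) (cos (f x) * a).
Proof. by move=> H; apply: der_comp. Qed.

Lemma is_derive_cvg f x a : is_derive x (1 : R) f a -> {for x, continuous f}.
Proof. by move=> H; apply: differentiable_continuous; apply/derivable1_diffP. Qed.

Lemma der_continuous f g : (forall x, is_derive x (1 : R) f (g x)) ->
  continuous f.
Proof. by move=> H x; exact: is_derive_cvg. Qed.

Lemma is_derive_unique f x a b : is_derive x (1 : R) f a ->
  is_derive x (1 : R) f b -> a = b.
Proof. by move=> [_ <-] [_ <-]. Qed.

Lemma is_derive_derive1 f x a : is_derive x (1 : R) f a -> derive1 f x = a.
Proof. by move=> [_ <-]; rewrite derive1E. Qed.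

(** Division-free form of differentiability. Remainder estimates that are uniform in x come in this
    shape, and can be added, averaged over a period, or evaluated at a moving point. *)
Lemma is_deriveP f x a :
  is_derive x (1 : R) f a <->
  forall e : R, 0 < e -> exists2 d : R, 0 < d & forall y : R, `|y - x| < d ->
    `|f y - f x - a * (y - x)| <= e * `|y - x|.
Proof.
split.
  move=> H e e0.
  have /derivable1_diffP H1 : derivable f x 1 by [].
  have [D HD] := H.
  have /cvgrPdist_le /(_ e e0) : (fun h => h^-1 *: (f (h + x) - f x)) @ 0^' --> a.
    move: D; rewrite /derivable => Dc.
    rewrite -HD /derive.
    have E : (fun h : R => h^-1 *: (f (h *: 1 + x) - f x)) =
        (fun h : R => h^-1 *: (f (h + x) - f x)).
      by apply/funext => h; rewrite /GRing.scale /= mulr1.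
    by move: Dc; rewrite E.
  rewrite /dnbhs near_withinE => /nbhs_ballP [d /= d0 Hd].
  exists d => // y yx.
  have [->|ynx] := eqVneq y x; first by rewrite !subrr mulr0 subr0 normr0 mulr0.
  have h0 : y - x != 0 by rewrite subr_eq0.
  have := Hd (y - x); rewrite /ball /= sub0r normrN => /(_ yx h0).
  rewrite subrK /GRing.scale /= => H2.
  have -> : f y - f x - a * (y - x) =
     - ((a - (y - x)^-1 * (f y - f x)) * (y - x)) by field.
  by rewrite normrN normrM ler_wpM2r.
move=> H.
have C : (fun h => h^-1 *: (f (h *: (1:R) + x) - f x)) @ 0^' --> a.
  apply/cvgrPdist_le => e e0; have [d d0 Hd] := H e e0.
  rewrite /dnbhs near_withinE; apply/nbhs_ballP; exists d => //= h.
  rewrite /ball /= sub0r normrN => hd h0.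
  have := Hd (h + x); rewrite addrK => /(_ hd).
  rewrite /GRing.scale /= mulr1 => H2.
  rewrite -(ler_pM2r (_ : 0 < `|h|)) ?normr_gt0 // -normrM -normrN.
  suff -> : - ((a - h^-1 * (f (h + x) - f x)) * h) = f (h + x) - f x - a * h by [].
  by field.
apply: DeriveDef; first by apply/cvg_ex; exists a.
by apply: cvg_lim C.
Qed.

Lemma MVT_le (a b : R) f df : a <= b ->
  (forall x, a < x < b -> is_derive x (1 : R) f (df x)) ->
  {within `[a, b], continuous f} ->
  exists2 c, a <= c <= b & f b - f a = df c * (b - a).
Proof.
rewrite le_eqVlt => /predU1P[-> _ _|ab Hd Hc].
  by exists b; rewrite ?lexx // !subrr mulr0.
have Hd' x : x \in `]a, b[%R -> is_derive x (1 : R) f (df x).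
  by rewrite in_itv /=; exact: Hd.
have [c cab E] := MVT ab Hd' Hc.
by exists c => //; move: cab; rewrite in_itv /= => /andP[/ltW -> /ltW ->].
Qed.

(** No order between [a] and [b] is imposed, and the intermediate point is located by its distance
    to [a]; this is what makes it converge to [a] together with [b]. *)
Lemma MVT_all (a b : R) f df :
  (forall x, is_derive x (1 : R) f (df x)) ->
  exists2 c, `|c - a| <= `|b - a| & f b - f a = df c * (b - a).
Proof.
move=> Hd; have C := der_continuous Hd.
have [ab|/ltW ab] := leP a b.
  have [c /andP[ac cb] E] := MVT_le ab (fun x _ => Hd x) (continuous_subspaceT C).
  by exists c => //; rewrite !ger0_norm ?subr_ge0 // lerD2r.
have [c /andP[ac cb] E] := MVT_le ab (fun x _ => Hd x) (continuous_subspaceT C).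
exists c; last by rewrite -(opprB (f a)) E -mulrN opprB.
by rewrite !ler0_norm ?subr_le0 // !opprB lerD2l lerN2.
Qed.

Lemma der0_cst f : (forall x, is_derive x (1 : R) f 0) -> forall x y, f x = f y.
Proof.
move=> H x y; have [c _ /eqP] := MVT_all y x H.
by rewrite mul0r subr_eq0 => /eqP.
Qed.

End Calculus.

(* Meant to run under [eapply is_derive_eq]: the derivative is an evar assembled by the rules and
   compared with the expected expression afterwards. [leaf] supplies the derivatives of the
   atoms. *)
Tactic Notation "der" tactic3(leaf) := repeat first
  [ eapply der_cst | eapply der_id | leaf | eapply derD | eapply derN
  | eapply derM | eapply derX2 | eapply der_expR | eapply der_cos
  | eapply der_sin ].

Section Continuity.
Context {T : topologicalType} {R : realType}.
Implicit Types f g : T -> R.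

Lemma cont_cst (c : R) : continuous (fun _ : T => c).
Proof. by move=> x; exact: cst_continuous. Qed.

Lemma contD f g : continuous f -> continuous g ->
  continuous (fun x => f x + g x).
Proof. by move=> cf cg x; exact: (cvgD (cf x) (cg x)). Qed.

Lemma contN f : continuous f -> continuous (fun x => - f x).
Proof. by move=> cf x; exact: (cvgN (cf x)). Qed.

Lemma contM f g : continuous f -> continuous g ->
  continuous (fun x => f x * g x).
Proof. by move=> cf cg x; exact: (cvgM (cf x) (cg x)). Qed.

Lemma contX f n : continuous f -> continuous (fun x => f x ^+ n).
Proof.
move=> cf; elim: n => [|n IH].
  by rewrite (_ : (fun x => _) = fun=> 1) ?funeqE//; exact: cont_cst.
rewrite (_ : (fun x => _) = (fun x => f x * f x ^+ n)); first exact: contM.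
by apply/funext => x; rewrite exprS.
Qed.

Lemma cont_comp f (h : R -> R) : continuous h -> continuous f ->
  continuous (fun x => h (f x)).
Proof. by move=> ch cf x; exact: (continuous_comp (cf x) (ch _)). Qed.

End Continuity.

Lemma cont_id {R : realType} : continuous (fun x : R => x).
Proof. by move=> x; exact: cvg_id. Qed.

Lemma contcos {R : realType} (T : topologicalType) (f : T -> R) :
  continuous f -> continuous (fun x => cos (f x)).
Proof. by apply: cont_comp => x; exact: continuous_cos. Qed.

Lemma contsin {R : realType} (T : topologicalType) (f : T -> R) :
  continuous f -> continuous (fun x => sin (f x)).
Proof. by apply: cont_comp => x; exact: continuous_sin. Qed.

(* Dispatching on the syntax of the body keeps the unifier from unfolding
   [continuous]. *)
Ltac cont := lazymatch goal with
  | |- continuous (fun _ => ?c) => exact: cont_cst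
  | |- continuous (fun x => x) => exact: cont_id
  | |- continuous (fun x => @?f x + @?g x) => apply: (@contD _ _ f g); cont
  | |- continuous (fun x => - @?f x) => apply: (@contN _ _ f); cont
  | |- continuous (fun x => @?f x * @?g x) => apply: (@contM _ _ f g); cont
  | |- continuous (fun x => @?f x ^+ ?n) => apply: (@contX _ _ f n); cont
  | |- continuous (fun x => cos (@?f x)) => apply: (@contcos _ _ f); cont
  | |- continuous (fun x => sin (@?f x)) => apply: (@contsin _ _ f); cont
  | |- continuous ?f => first
      [ let f' := eval cbv beta in (fun x => f x) in
        lazymatch f' with (fun x => ?h x) =>
          match goal with H : continuous h |- _ => exact H end end
      | match goal with H : continuous _ |- _ => exact H end
      | done ]
  | |- _ => idtac
  end.

(** * Primitives of continuous functions on the whole line *)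

Section Primitive.
Context {R : realType}.
Implicit Types f g : R -> R.
Notation mu := lebesgue_measure.

Lemma cont_integrable f (a b : R) : continuous f ->
  mu.-integrable `[a, b] (EFin \o f).
Proof.
move=> cf; apply: continuous_compact_integrable; first exact: segment_compact.
exact: continuous_subspaceT.
Qed.

(** The fundamental theorem is used from a finite left endpoint, so [P n] is a primitive only to the
    right of -(n+1). Normalised at 0, these functions agree where both are primitives; letting the
    index grow with |x| glues them together. *)
Lemma primitive_exists f : continuous f ->
  exists F : R -> R, F 0 = 0 /\ forall x, is_derive x (1 : R) F (f x).
Proof.
move=> cf.
pose I (n : nat) (x : R) : R := \int[mu]_(t in `[- n.+1%:R, x]) f t.
pose P (n : nat) (x : R) : R := I n x - I n 0.
have dP (n : nat) (x : R) : - n.+1%:R < x -> is_derive x (1 : R) (P n) (f x).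
  move=> nx; have [] := @continuous_FTC1_closed R f (- n.+1%:R) x (x + 1) _ _ nx (cf x).
  - by rewrite ltrDl.
  - exact: cont_integrable.
  - move=> D E.
    have : is_derive x (1 : R) (I n) (f x) by apply: DeriveDef; [exact: D | rewrite
      -derive1E; exact: E].
    by move=> H; exact: (is_derive_eq (derD H (der_cst (- I n 0) x)) (addr0 _)).
have P0 (n : nat) : P n 0 = 0 by rewrite /P subrr.
have PE (n m : nat) (x : R) : (n <= m)%N -> - n.+1%:R < x -> P n x = P m x.
  move=> nm nx.
  have mx : - m.+1%:R < x by apply: le_lt_trans nx; rewrite lerN2 ler_nat ltnS.
  pose D (y : R) := P n y - P m y.
  have dD (y : R) : - n.+1%:R < y -> is_derive y (1 : R) D 0.
    move=> ny.
    have my : - m.+1%:R < y by apply: le_lt_trans ny; rewrite lerN2 ler_nat ltnS.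
    exact: (is_derive_eq (derD (dP n y ny) (derN (dP m y my))) (subrr _)).
  have D0 : D 0 = 0 by rewrite /D !P0 subrr.
  have n0 : - n.+1%:R < 0 :> R by rewrite oppr_lt0 ltr0n.
  suff : D x = 0 by move/eqP; rewrite subr_eq0 => /eqP.
  have W (a b : R) : - n.+1%:R < a -> {within `[a, b], continuous D}.
    move=> na; apply: derivable_within_continuous => z.
    by rewrite in_itv /= => /andP[az _]; apply: ex_derive; apply: dD; apply: lt_le_trans az.
  have [x0|/ltW x0] := leP 0 x.
    have [|c _] := @MVT_le R 0 x D (fun=> 0) x0 _ (W _ _ n0).
      by move=> z /andP[z0 _]; apply: dD; apply: lt_trans z0.
    by rewrite mul0r D0 subr0.
  have [|c _] := @MVT_le R x 0 D (fun=> 0) x0 _ (W _ _ nx).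
    by move=> z /andP[z0 _]; apply: dD; apply: lt_trans z0.
  by rewrite mul0r D0 sub0r => /eqP; rewrite oppr_eq0 => /eqP.
pose N (x : R) := Num.truncn `|x|.
have NP (x : R) : - (N x).+1%:R < x.
  rewrite ltrNl; apply: le_lt_trans (truncnS_gt _) => //.
  by rewrite -normrN ler_norm.
exists (fun x => P (N x) x); split; first exact: P0.
(* A single index that serves the whole unit ball around [x]: [N y <= M] for every [y] in it. *)
move=> x; pose M := N (`|x| + 1).
have Mx : - M.+1%:R < x.
  rewrite ltrNl; apply: le_lt_trans (truncnS_gt _) => //.
  by rewrite ger0_norm ?addr_ge0 // (le_trans (ler_norm (-x))) // normrN lerDl.
apply: near_eq_is_derive (dP M x Mx) => //.
apply/nbhs_ballP; exists 1; first exact: ltr01.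
move=> y xy'; have {xy'} xy : `|x - y| < 1 := xy'.
apply/esym/PE; last exact: NP.
apply: le_truncn; rewrite [leRHS]ger0_norm ?addr_ge0 // -lerBlDl.
by rewrite (le_trans (lerB_dist _ _)) // distrC ltW.
Qed.

End Primitive.

(** * Means over a period and Fourier coefficients *)

Section Mean.
Context {R : realType}.
Implicit Types f g F G : R -> R.

(** Together with [primitive_exists] this turns the rules for [mean] of continuous functions into
    rules for derivatives, free of integrability side conditions. *)
Lemma mean_FTC F f : (forall x, is_derive x (1 : R) F (f x)) -> continuous f ->
  mean f = F 1 - F 0.
Proof.
move=> dF cf; rewrite /mean /Rintegral (@continuous_FTC2 _ f F 0 1) //.
- exact: continuous_subspaceT.
- have cF := der_continuous dF; split.
  + by move=> x _; exact: ex_derive.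
  + exact/cvg_at_right_filter/cF.
  + exact/cvg_at_left_filter/cF.
- by move=> x _; apply: is_derive_derive1.
Qed.

Lemma meanD f g : continuous f -> continuous g ->
  mean (fun x => f x + g x) = mean f + mean g.
Proof.
move=> cf cg; have [F [F0 dF]] := primitive_exists cf.
have [G [G0 dG]] := primitive_exists cg.
rewrite (mean_FTC dF cf) (mean_FTC dG cg) (@mean_FTC (fun x => F x + G x)).
- ring.
- by cont.
Qed.

Lemma meanZ (c : R) f : continuous f -> mean (fun x => c * f x) = c * mean f.
Proof.
move=> cf; have [F [F0 dF]] := primitive_exists cf.
have dcF (x : R) : is_derive x (1 : R) (fun x => c * F x) (c * f x).
  apply: (is_derive_eq (derM (der_cst c x) (dF x))).
  by rewrite mul0r add0r.
rewrite (mean_FTC dF cf) (mean_FTC dcF); first by rewrite mulrBr.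
by cont.
Qed.

Lemma meanN f : continuous f -> mean (fun x => - f x) = - mean f.
Proof.
move=> cf; rewrite -mulN1r -meanZ //; congr mean; apply/funext => x.
by rewrite mulN1r.
Qed.

Lemma meanB f g : continuous f -> continuous g ->
  mean (fun x => f x - g x) = mean f - mean g.
Proof. by move=> cf cg; rewrite meanD ?meanN //; cont. Qed.

Lemma mean_cst (c : R) : mean (fun=> c) = c.
Proof.
have dc (x : R) : is_derive x (1 : R) (fun x => c * x) c.
  apply: (is_derive_eq (derM (der_cst c x) (der_id x))).
  by rewrite mul0r add0r mulr1.
by rewrite (mean_FTC dc) ?mulr1 ?mulr0 ?subr0 //; exact: cont_cst.
Qed.

(** Cutting the period at [a] and [b], the mean value theorem bounds each increment of a primitive.
    It serves to detect the mass of a function peaked on [a, b]. *)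
Lemma mean_ge_sub f (a b m : R) : continuous f ->
  0 <= a -> a <= b -> b <= 1 -> (forall x, 0 <= x <= 1 -> 0 <= f x) ->
  (forall x, a <= x <= b -> m <= f x) -> m * (b - a) <= mean f.
Proof.
move=> cf a0 ab b1 f0 fm; have [F [F0 dF]] := primitive_exists cf.
rewrite (mean_FTC dF cf); have cF := der_continuous dF.
have H (u v : R) : u <= v -> exists2 c, u <= c <= v & F v - F u = f c * (v - u).
  by move=> uv; apply: MVT_le => // ; exact: continuous_subspaceT.
have [c /andP[ac cb] E1] := H _ _ ab.
have [d /andP[ad db] E2] := H _ _ a0.
have [e /andP[ae eb] E3] := H _ _ b1.
have h1 : m * (b - a) <= F b - F a.
  by rewrite E1 ler_wpM2r ?subr_ge0 // fm // ac cb.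
have h2 : 0 <= F a - F 0.
  by rewrite E2 mulr_ge0 ?subr_ge0 // f0 // ad (le_trans db (le_trans ab b1)).
have h3 : 0 <= F 1 - F b.
  by rewrite E3 mulr_ge0 ?subr_ge0 // f0 // eb andbT (le_trans a0 (le_trans ab ae)).
lra.
Qed.

Lemma mean_ge0 f : continuous f -> (forall x, 0 <= x <= 1 -> 0 <= f x) ->
  0 <= mean f.
Proof.
move=> cf f0; have := @mean_ge_sub f 0 1 0 cf (lexx _) ler01 (lexx _) f0 f0.
by rewrite mul0r.
Qed.

Lemma mean_le f g : continuous f -> continuous g ->
  (forall x, 0 <= x <= 1 -> f x <= g x) -> mean f <= mean g.
Proof.
move=> cf cg fg; rewrite -subr_ge0 -meanB //; apply: mean_ge0; first by cont.
by move=> x x01; rewrite subr_ge0 fg.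
Qed.

Lemma mean_abs_le f (M : R) : continuous f ->
  (forall x, `|f x| <= M) -> `|mean f| <= M.
Proof.
move=> cf fM; rewrite ler_norml; apply/andP; split.
  rewrite -[X in X <= _]mean_cst; apply: mean_le => //; first exact: cont_cst.
  by move=> x _; have := fM x; rewrite ler_norml => /andP[].
rewrite -[X in _ <= X]mean_cst; apply: mean_le => //; first exact: cont_cst.
by move=> x _; have := fM x; rewrite ler_norml => /andP[].
Qed.

Lemma mean_der0 F f : (forall x, is_derive x (1 : R) F (f x)) -> continuous f ->
  periodic F 1 -> mean f = 0.
Proof. by move=> dF cf pF; rewrite (mean_FTC dF cf) -[in F 1](add0r 1) pF subrr. Qed.

Lemma mean_by_parts F G f g :
  (forall x, is_derive x (1 : R) F (f x)) ->
  (forall x, is_derive x (1 : R) G (g x)) -> continuous f -> continuous g ->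
  periodic F 1 -> periodic G 1 ->
  mean (fun x => F x * g x) = - mean (fun x => f x * G x).
Proof.
move=> dF dG cf cg pF pG.
have cF := der_continuous dF; have cG := der_continuous dG.
have : mean (fun x => f x * G x + F x * g x) = 0.
  apply: (mean_der0 (fun x => derM (dF x) (dG x))); first by cont.
  by move=> x; rewrite pF pG.
rewrite meanD; [|by cont|by cont].
by move/eqP; rewrite addrC addr_eq0 => /eqP.
Qed.

End Mean.

Section Trig.
Context {R : realType}.
Implicit Types (f g : R -> R) (n : int) (x : R).

Definition cosn n x : R := cos (2 * pi * n%:~R * x).
Definition sinn n x : R := sin (2 * pi * n%:~R * x).

Lemma trig_2pi_int n :
  cos (2 * pi * n%:~R : R) = 1 /\ sin (2 * pi * n%:~R : R) = 0.
Proof.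
have H (k : nat) : cos (2 * pi * k%:R : R) = 1 /\ sin (2 * pi * k%:R : R) = 0.
  have -> : 2 * pi * k%:R = 0 + pi *+ 2 *+ k :> R.
    by rewrite add0r -(mulr_natl pi) mulr_natr.
  by rewrite (periodicn (@cosD2pi R)) (periodicn (@sinD2pi R)) cos0 sin0.
case: n => k; first exact: H.
have [h1 h2] := H k.+1.
by rewrite NegzE mulrNz mulrN cosN sinN h1 h2 oppr0.
Qed.

Lemma cosn_periodic n : periodic (cosn n) 1.
Proof.
move=> x; rewrite /cosn mulrDr mulr1 cosD.
by have [-> ->] := trig_2pi_int n; rewrite mulr1 mulr0 subr0.
Qed.

Lemma sinn_periodic n : periodic (sinn n) 1.
Proof.
move=> x; rewrite /sinn mulrDr mulr1 sinD.
by have [-> ->] := trig_2pi_int n; rewrite mulr1 mulr0 addr0.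
Qed.

Lemma der_cosn n x : is_derive x (1 : R) (cosn n) (- (2 * pi * n%:~R) * sinn n x).
Proof.
eapply is_derive_eq; [rewrite /cosn; der fail | rewrite /sinn /=; ring].
Qed.

Lemma der_sinn n x : is_derive x (1 : R) (sinn n) (2 * pi * n%:~R * cosn n x).
Proof.
eapply is_derive_eq; [rewrite /sinn; der fail | rewrite /cosn /=; ring].
Qed.

Lemma cont_cosn n : continuous (cosn n).
Proof. exact: der_continuous (der_cosn n). Qed.

Lemma cont_sinn n : continuous (sinn n).
Proof. exact: der_continuous (der_sinn n). Qed.

Lemma fourier_cosE f n : fourier_cos f n = mean (fun x => f x * cosn n x).
Proof. by []. Qed.

Lemma fourier_sinE f n : fourier_sin f n = mean (fun x => f x * sinn n x).
Proof. by []. Qed.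

End Trig.

(** * A continuous periodic function is determined by its Fourier coefficients *)

Section Uniqueness.
Context {R : realType}.
Implicit Types (f g : R -> R) (n : int) (x : R).

Definition fourier_trivial f :=
  forall n, fourier_cos f n = 0 /\ fourier_sin f n = 0.

(** By the product-to-sum formulas, the coefficients of index n of the product are combinations of
    those of [f] at n - 1, n and n + 1. Iteration allows powers of a trigonometric polynomial of
    degree one. *)
Lemma fourier_trivialM f (a b c : R) : continuous f -> fourier_trivial f ->
  fourier_trivial (fun x => f x * (a * cosn 1 x + b * sinn 1 x + c)).
Proof.
move=> cf zf n.
have A x : 2 * pi * (n + 1)%:~R * x = 2 * pi * n%:~R * x + 2 * pi * 1%:~R * x.
  by rewrite intrD; ring.
have B x : 2 * pi * (n - 1)%:~R * x = 2 * pi * n%:~R * x - 2 * pi * 1%:~R * x.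
  by rewrite intrB; ring.
have [zc1 zs1] := zf (n + 1); have [zc2 zs2] := zf (n - 1).
have [zc0 zs0] := zf n.
have CC m (d : R) : continuous (fun x => d * (f x * cosn m x)).
  by have := @cont_cosn R m => cm; cont.
have CS m (d : R) : continuous (fun x => d * (f x * sinn m x)).
  by have := @cont_sinn R m => cm; cont.
have MC m (d : R) : mean (fun x => d * (f x * cosn m x)) = d * fourier_cos f m.
  rewrite fourier_cosE meanZ //; have := @cont_cosn R m => cm; cont.
have MS m (d : R) : mean (fun x => d * (f x * sinn m x)) = d * fourier_sin f m.
  rewrite fourier_sinE meanZ //; have := @cont_sinn R m => cm; cont.
split.
- rewrite fourier_cosE.
  rewrite (_ : (fun x => _) = fun x =>
     a / 2 * (f x * cosn (n + 1) x) + a / 2 * (f x * cosn (n - 1) x)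
     + b / 2 * (f x * sinn (n + 1) x) + - (b / 2) * (f x * sinn (n - 1) x)
     + c * (f x * cosn n x)); last first.
    by apply/funext => x; rewrite /cosn /sinn A B cosD cosB sinD sinB; field.
  rewrite !meanD; [|by repeat (apply: contD || done)..].
  by rewrite !(MC, MS) zc1 zs1 zc2 zs2 zc0; ring.
- rewrite fourier_sinE.
  rewrite (_ : (fun x => _) = fun x =>
     a / 2 * (f x * sinn (n + 1) x) + a / 2 * (f x * sinn (n - 1) x)
     + - (b / 2) * (f x * cosn (n + 1) x) + (b / 2) * (f x * cosn (n - 1) x)
     + c * (f x * sinn n x)); last first.
    by apply/funext => x; rewrite /cosn /sinn A B cosD cosB sinD sinB; field.
  rewrite !meanD; [|by repeat (apply: contD || done)..].
  by rewrite !(MC, MS) zc1 zs1 zc2 zs2 zs0; ring.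
Qed.

Lemma periodic_int f n x : periodic f 1 -> f (x + n%:~R) = f x.
Proof.
move=> pf; have H (k : nat) y : f (y + k%:R) = f y by rewrite (periodicn pf).
case: n => k; first exact: H.
by rewrite NegzE mulrNz -(H k.+1 (x - _)) subrK.
Qed.

(** Quantifies the divergence of geometric sequences, both for the peaked kernel below and for the
    tails 2^-n of the Picard iteration. *)
Lemma bernoulli_pow (r : R) (k : nat) : 1 <= r -> 1 + k%:R * (r - 1) <= r ^+ k.
Proof.
move=> r1; elim: k => [|k IH]; first by rewrite mul0r addr0 expr0.
rewrite exprS; apply: (@le_trans _ _ (r * (1 + k%:R * (r - 1)))); last first.
  by rewrite ler_wpM2l // (le_trans ler01).
have k0 : 0 <= k%:R :> R by [].
have := mulr_ge0 k0 (sqr_ge0 (r - 1)).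
rewrite -natr1; nra.
Qed.

(* The factor K = 1 + cos (2 pi (x - x1)) - cos (2 pi d) exceeds 1 near x1 and
   has modulus at most 1 at distance >= d from it, and f K^k still has only
   trivial Fourier coefficients. *)
Lemma fourier_trivial_le0_inner f x1 : continuous f -> fourier_trivial f ->
  0 < x1 < 1 -> f x1 <= 0.
Proof.
move=> cf zf /andP[x10 x11]; rewrite leNgt; apply/negP => fx1.
pose e := f x1 / 2; have e0 : 0 < e by rewrite divr_gt0.
have [d [d0 dx dx1 fd]] : exists d : R, [/\ 0 < d, d <= x1, d <= 1 - x1 &
    forall x, `|x - x1| < d -> e <= f x].
  have /cvgrPdist_lt /(_ e e0) := cf x1.
  move=> /nbhs_ballP [d /= d0 Hd].
  (* Shrinking d keeps [x1 - d, x1 + d] inside the period. *)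
  exists (Num.min d (Num.min x1 (1 - x1))); split.
  - by rewrite !lt_min d0 x10 subr_gt0.
  - by rewrite !ge_min lexx !orbT.
  - by rewrite !ge_min lexx !orbT.
  - move=> x; rewrite lt_min => /andP[xd _].
    have := Hd x; rewrite /ball /= distrC => /(_ xd).
    rewrite ltr_norml => /andP[_ H]; move: H; rewrite /e; lra.
have cnf : continuous (fun x => `|f x|).
  by apply: cont_comp => // x; exact: norm_continuous.
have [c c01 fM] := @EVT_max R (fun x => `|f x|) 0 1 ler01 (continuous_subspaceT cnf).
pose M := `|f c|.
have M0 : 0 <= M by exact: normr_ge0.
have fM' x : 0 <= x <= 1 -> `|f x| <= M.
  by move=> x01; apply: fM; rewrite in_itv.
have pi0 := @pi_gt0 R.
(* Expanded by the addition formula into the shape required by [fourier_trivialM]. *)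
pose K x : R := cos (2 * pi * x1) * cosn 1 x + sin (2 * pi * x1) * sinn 1 x
             + (1 - cos (2 * pi * d)).
have KE x : K x = 1 + cos (2 * pi * `|x - x1|) - cos (2 * pi * d).
  have -> : cos (2 * pi * `|x - x1|) = cos (2 * pi * x - 2 * pi * x1).
    by rewrite -mulrBr -[RHS]cos_norm normrM ger0_norm // mulr_ge0 // ltW.
  by rewrite /K /cosn /sinn cosB mulr1; ring.
have cK : continuous K.
  have c1 := @cont_cosn R 1; have s1 := @cont_sinn R 1.
  by rewrite /K; cont.
have zK (k : nat) : fourier_trivial (fun x => f x * K x ^+ k).
  elim: k => [|k IH].
    by rewrite (_ : (fun x => _) = f) //; apply/funext => x; rewrite expr0 mulr1.
  rewrite (_ : (fun x => _) = fun x => (f x * K x ^+ k) * K x).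
    by apply: fourier_trivialM IH; cont.
  by apply/funext => x; rewrite exprSr mulrA.
have mK (k : nat) : mean (fun x => f x * K x ^+ k) = 0.
  have [+ _] := zK k 0; rewrite fourier_cosE => H; rewrite -[RHS]H.
  by congr mean; apply/funext => x; rewrite /cosn mulr0 mul0r cos0 mulr1.
(* The value of [K] at distance d / 2 from x1, hence its minimum over the ball of radius d / 2. *)
pose rho := 1 + cos (pi * d) - cos (2 * pi * d).
have rho1 : 1 < rho.
  have : cos (2 * pi * d) < cos (pi * d).
    rewrite ltr_cos ?in_itv /=; [|nra|nra]; nra.
  rewrite /rho; lra.
have Kout x : 0 <= x <= 1 -> d <= `|x - x1| -> `|K x| <= 1.
  move=> /andP[x0 x1'] dx'; rewrite KE.
  set y := `|x - x1| in dx' *.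
  have y1 : y <= 1 - d by rewrite /y ler_norml; apply/andP; split; lra.
  (* The cosine decreases on half a period only; since d <= y <= 1 - d, a distance y > 1/2 is
     replaced by 1 - y, which is again at least d. *)
  have Hc z : d <= z -> z <= 2^-1 -> cos (2 * pi * z) <= cos (2 * pi * d).
    move=> dz z2; rewrite leNgt ltr_cos ?in_itv /= -?leNgt; nra.
  have : cos (2 * pi * y) <= cos (2 * pi * d).
    have [y2|/ltW y2] := leP y 2^-1; first exact: Hc.
    have -> : cos (2 * pi * y) = cos (2 * pi * (1 - y)).
      rewrite -[LHS]cosN -cosD2pi; congr cos; rewrite -mulr_natl; ring.
    by apply: Hc; lra.
  have := cos_geN1 (2 * pi * y); have := cos_le1 (2 * pi * d).
  by rewrite ler_norml => *; apply/andP; split; lra.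
have Kge x z : `|x - x1| <= z -> z <= d -> 1 + cos (2 * pi * z) - cos (2 * pi * d) <= K x.
  move=> xz zd; rewrite KE; set y := `|x - x1| in xz *.
  have y0 : 0 <= y by exact: normr_ge0.
  have : cos (2 * pi * z) <= cos (2 * pi * y).
    rewrite leNgt ltr_cos ?in_itv /= -?leNgt; nra.
  lra.
have key (k : nat) : e * rho ^+ k * d <= M.
  (* Adding [M] does not disturb the argument, the mean of [f K^k] being 0, and makes the integrand
     nonnegative: far from x1 because |K| <= 1, near x1 because both factors are nonnegative. On the
     ball of radius d / 2, of length d, it is at least e rho^k. *)
  pose g x := f x * K x ^+ k + M.
  have cg : continuous g by rewrite /g; cont.
  have <- : mean g = M by rewrite /g meanD ?mK ?mean_cst ?add0r; cont.
  have -> : d = (x1 + d / 2) - (x1 - d / 2) by field.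
  apply: (@mean_ge_sub R g) => //; [lra|lra|lra| |].
  - move=> x x01; rewrite /g; have [xd|xd] := leP d `|x - x1|.
      have : `|K x ^+ k| <= 1 by rewrite normrX exprn_ile1 // Kout.
      move=> h.
      have := ler_pM (normr_ge0 _) (normr_ge0 _) (fM' x x01) h.
      by rewrite mulr1 -normrM ler_norml => /andP[]; lra.
    have h0 : e <= f x by apply: fd.
    have h1 : 0 <= K x by have := Kge _ _ (lexx _) (ltW xd); have := Kge x d (ltW xd)
      (lexx _); lra.
    by rewrite addr_ge0 // mulr_ge0 ?exprn_ge0 // (le_trans (ltW e0)).
  - move=> x xd; have xd2 : `|x - x1| <= d / 2 by rewrite ler_norml; lra.
    have h0 : e <= f x by apply: fd; lra.
    have h1 : rho <= K x.
      apply: le_trans (Kge _ _ xd2 _); last lra.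
      by rewrite /rho (_ : 2 * pi * (d / 2) = pi * d) //; field.
    rewrite /g -[leLHS]addr0 lerD // ler_pM ?(ltW e0) // ?exprn_ge0; try lra.
    by rewrite lerXn2r // nnegrE; lra.
(* Large enough that already the linear lower bound of rho^k contradicts [key]. *)
pose k := (Num.truncn (M / (e * d * (rho - 1)))).+1.
have h1 := bernoulli_pow k (ltW rho1).
have h2 : M < k%:R * (e * d * (rho - 1)).
  by rewrite -ltr_pdivrMr ?truncnS_gt // !mulr_gt0 // subr_gt0.
have := key k; have := ler_wpM2l (ltW (mulr_gt0 e0 d0)) h1.
have := mulr_gt0 e0 d0; lra.
Qed.

(** The previous bound is applied to [f] and to [- f]. It covers the open period only; a positive
    value at an integer would persist, by continuity, at a nearby interior point. *)
Lemma fourier_trivial_eq0 f x : continuous f -> periodic f 1 ->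
  fourier_trivial f -> f x = 0.
Proof.
move=> cf pf zf.
suff H g : continuous g -> periodic g 1 -> fourier_trivial g -> g x <= 0.
  apply/eqP; rewrite eq_le H //= -oppr_le0 (H (fun y => - f y)) //.
  - by cont.
  - by move=> y; rewrite pf.
  - have cc n := @cont_cosn R n; have ss n := @cont_sinn R n.
    move=> n; have [h1 h2] := zf n; rewrite fourier_cosE fourier_sinE.
    have E1 : (fun x0 => - f x0 * cosn n x0) = fun x0 => - (f x0 * cosn n x0).
      by apply/funext => y; rewrite mulNr.
    have E2 : (fun x0 => - f x0 * sinn n x0) = fun x0 => - (f x0 * sinn n x0).
      by apply/funext => y; rewrite mulNr.
    rewrite E1 E2 !meanN; [|by cont..].
    by rewrite -fourier_cosE -fourier_sinE h1 h2 oppr0.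
move=> {cf pf zf f} cg pg zg.
rewrite leNgt; apply/negP.
rewrite -(@periodic_int g (- Num.floor x) x pg) mulrNz.
have := floor_itv x; rewrite intrD.
set y := x - _ => H gy.
have [y0 y1] : 0 <= y /\ y < 1 by move: H; rewrite /y => /andP[]; split; lra.
have gy2 : 0 < g y / 2 by rewrite divr_gt0.
have /cvgrPdist_lt /(_ _ gy2) := cg y.
move=> /nbhs_ballP [d /= d0 Hd].
(* [y] may be 0, so it is moved to the right: by less than d to keep [g] positive, and by less than
   1 - y to stay in the open period. *)
pose z := y + Num.min (d / 2) ((1 - y) / 2).
have h1 : 0 < Num.min (d / 2) ((1 - y) / 2) by rewrite lt_min; lra.
have h2 : Num.min (d / 2) ((1 - y) / 2) <= d / 2 by rewrite ge_min lexx.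
have h3 : Num.min (d / 2) ((1 - y) / 2) <= (1 - y) / 2 by rewrite ge_min lexx orbT.
have := @fourier_trivial_le0_inner g z cg zg; rewrite /z => H2.
have : g z <= 0 by apply: H2; lra.
have := Hd z; rewrite /ball /= => Hz.
have : `|g y - g z| < g y / 2 by apply: Hz; rewrite ltr_norml /z; lra.
rewrite ltr_norml; lra.
Qed.

End Uniqueness.

(** * Sobolev embedding *)

Section Energy.
Context {R : realType}.
Implicit Types (f g : R -> R) (A B : nat -> R) (s e : R).

Definition weight s (n : int) : R := powR (1 + (2 * pi * n%:~R) ^+ 2) s.

Lemma weight_gt0 s n : 0 < weight s n.
Proof. by apply: powR_gt0; rewrite ltr_pwDl // sqr_ge0. Qed.

(** Only the frequencies 0, ..., N - 1 are kept: for a real function the negative ones carry the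
    same information, and finite sums suffice for what follows. *)
Lemma sobolev_norm_energy s f e (N : nat) : 0 <= e ->
  (sobolev_norm s f <= e%:E)%E ->
  \sum_(k < N) weight s k * (fourier_cos f k ^+ 2 + fourier_sin f k ^+ 2)
    <= e ^+ 2.
Proof.
move=> e0; rewrite /sobolev_norm; set S := esum _ _ => Se.
have pos (n : int) : (0 <= (weight s n *
    (fourier_cos f n ^+ 2 + fourier_sin f n ^+ 2))%:E)%E.
  by rewrite lee_fin mulr_ge0 // ?(ltW (weight_gt0 _ _)) // addr_ge0 // sqr_ge0.
have S0 : (0 <= S)%E by apply: esum_ge0 => n _; exact: pos.
have SE : (S <= (e ^+ 2)%:E)%E.
  have H : (poweR (poweR S 2^-1) 2 <= poweR e%:E 2)%E.
    by apply: gt0_ler_poweR => //; rewrite /= in_itv /= ?poweR_ge0 ?lee_fin ?e0 leey.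
  move: H; rewrite -poweRrM mulVf // poweRe1 // poweR_EFin.
  by rewrite (powR_mulrn 2 e0).
rewrite -lee_fin; apply: le_trans SE; apply: esum_ge.
exists (Posz @` `I_N).
  by split => //; apply: finite_image; exact: finite_II.
rewrite fsbig_image /=; last by move=> x y _ _ [].
by rewrite -fsbig_ord sumEFin.
Qed.

Lemma weight_ge s (k j : nat) : 0 <= s -> (2 ^ j <= k)%N ->
  powR 4 s ^+ j <= weight s k.
Proof.
move=> s0 jk; rewrite -powR_mulrn ?powR_ge0 // -powRrM mulrC powRrM /weight.
apply: ge0_ler_powR; rewrite ?nnegrE ?powR_ge0 //.
  by rewrite addr_ge0 // sqr_ge0.
rewrite powR_mulrn // (_ : 4 = 2 ^+ 2 :> R); last by rewrite expr2; ring.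
rewrite -exprM mulnC exprM.
have h : 2 ^+ j <= k%:R :> R by rewrite -natrX ler_nat.
have k0 : 0 <= k%:R :> R by [].
have p2 := @pi_ge2 R.
have : (2 ^+ j) ^+ 2 <= k%:R ^+ 2 :> R by rewrite lerXn2r // nnegrE // exprn_ge0.
have : k%:R ^+ 2 <= (2 * pi * k%:R) ^+ 2 :> R.
  by rewrite lerXn2r // ?nnegrE; nra.
have -> : (Posz k)%:~R = k%:R :> R by [].
lra.
Qed.

(** Cauchy condensation: the block of indices from 2^J to 2^(J+1) has 2^J terms, each at most 4^(-s
    J), so it contributes at most q^J with q = 2 / 4^s, and q < 1 exactly when s > 1/2. *)
Lemma weight_inv_sum_bound s : 2^-1 < s ->
  exists2 Z : R, 0 <= Z & forall N : nat, \sum_(k < N) (weight s k)^-1 <= Z.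
Proof.
move=> s2; pose G : R := powR 4 s.
have G2 : 2 < G.
  rewrite /G (_ : 2 = powR 4 2^-1 :> R); last first.
    rewrite (_ : 4 = powR 2 2 :> R); last by rewrite powR_mulrn // expr2; ring.
    by rewrite -powRrM mulfV // powRr1.
  rewrite (_ : s = 2^-1 + (s - 2^-1)); last by ring.
  rewrite powRD; last by apply/implyP => _; rewrite pnatr_eq0.
  have h : powR 1 (s - 2^-1) < powR 4 (s - 2^-1) :> R.
    by apply: gt0_ltr_powR; rewrite ?nnegrE ?ltr1n // subr_gt0.
  by rewrite ltr_pMr ?powR_gt0 //; move: h; rewrite powR1.
have G0 : 0 < G by lra.
pose q := 2 / G; have q0 : 0 < q by rewrite divr_gt0.
have q1 : q < 1 by rewrite /q ltr_pdivrMr // mul1r.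
pose c := (1 - q)^-1; have c0 : 0 < c by rewrite invr_gt0 subr_gt0.
have cq : c * (1 - q) = 1 by rewrite mulVf // gt_eqF // subr_gt0.
(* The extra term is the remaining geometric tail: c (1 - q) = 1 gives q^J + c q^(J+1) = c q^J, so
   the bound survives each new block. *)
have H J : \sum_(k < 2 ^ J) (weight s k)^-1 + c * q ^+ J <= 1 + c.
  elim: J => [|J IH].
    rewrite expn0 big_ord1 expr0 mulr1 lerD2r /weight.
    by rewrite mulr0z mulr0 expr0n /= addr0 powR1 invr1.
  rewrite expnS mul2n -addnn big_split_ord /=.
  have B : \sum_(i < 2 ^ J) (weight s (rshift (2 ^ J) i))^-1 <= q ^+ J.
    apply: (@le_trans _ _ (\sum_(i < 2 ^ J) (G ^+ J)^-1)).
      apply: ler_sum => i _; rewrite lef_pV2 ?posrE ?exprn_gt0 ?weight_gt0 //.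
      by apply: weight_ge; [lra | exact: leq_addr].
    rewrite sumr_const card_ord /q expr_div_n -[leLHS]mulr_natr natrX mulrC.
    exact: lexx.
  rewrite exprS; have : q ^+ J * (c * (1 - q)) = q ^+ J by rewrite cq mulr1.
  move: IH B; set S1 := \sum_(i < _) _; set S2 := \sum_(i < _) _.
  lra.
exists (1 + c); first lra.
move=> N; have /subnKC E := ltnW (ltn_expl N (isT : (1 < 2)%N)).
apply: le_trans (_ : \sum_(k < 2 ^ N) (weight s k)^-1 <= _).
  rewrite -E big_split_ord /= lerDl sumr_ge0 // => i _.
  by rewrite invr_ge0 ltW // weight_gt0.
by have := H N; have : 0 <= c * q ^+ N; [rewrite mulr_ge0 ?exprn_ge0 ?ltW | lra].
Qed.

(* AM-GM: |a| <= (e / w + w a^2 / e) / 2. *)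
Lemma coef_sum_bound s : 2^-1 < s -> exists2 C : R, 0 < C &
  forall A B e, 0 < e ->
    (forall N : nat, \sum_(k < N) weight s k * (A k ^+ 2 + B k ^+ 2) <= e ^+ 2) ->
    forall N : nat, \sum_(k < N) (`|A k| + `|B k|) <= C * e.
Proof.
move=> s2; have [Z Z0 HZ] := weight_inv_sum_bound s2.
exists (Z + 1); first lra.
move=> A B e e0 HE N.
have amgm (w a : R) : 0 < w -> `|a| <= 2^-1 * (e * w^-1 + w * a ^+ 2 / e).
  move=> w0; rewrite -(normr_id a) -[in leRHS](real_normK (num_real a)).
  rewrite normr_id.
  have := sqr_ge0 (e - w * `|a|); set b := `|a| => h.
  have -> : 2^-1 * (e * w^-1 + w * b ^+ 2 / e) = b + (e - w * b) ^+ 2 / (2 * w * e).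
    by field; rewrite !gt_eqF.
  by rewrite lerDl divr_ge0 // ltW // !mulr_gt0.
apply: (@le_trans _ _ (\sum_(k < N) (e * (weight s k)^-1 +
    (2 * e)^-1 * (weight s k * (A k ^+ 2 + B k ^+ 2))))).
  apply: ler_sum => k _; have w0 := weight_gt0 s k.
  have := lerD (amgm _ (A k) w0) (amgm _ (B k) w0) => h; apply: le_trans h _.
  rewrite le_eqVlt; apply/orP; left; apply/eqP; field.
  by rewrite !gt_eqF.
rewrite big_split /= -!mulr_sumr.
have h1 := ler_wpM2l (ltW e0) (HZ N).
have h2 : (2 * e)^-1 * (\sum_(k < N) weight s k * (A k ^+ 2 + B k ^+ 2)) <= 2^-1 * e.
  have -> : 2^-1 * e = (2 * e)^-1 * e ^+ 2 by field; rewrite gt_eqF.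
  by apply: ler_wpM2l => //; rewrite invr_ge0 mulr_ge0 // ltW.
nra.
Qed.

End Energy.

(** * Absolutely summable trigonometric series *)

Section TrigSeries.
Context {R : realType}.
Implicit Types (f g : R -> R) (n : int) (x : R).

Lemma mean_sum (N : nat) (F : nat -> R -> R) :
  (forall k, continuous (F k)) ->
  continuous (fun x => \sum_(k < N) F k x) /\
  mean (fun x => \sum_(k < N) F k x) = \sum_(k < N) mean (F k).
Proof.
move=> cF; elim: N => [|N [cN mN]].
  rewrite big_ord0 (_ : (fun x => _) = fun=> 0); first by split; [exact: cont_cst |
    exact: mean_cst].
  by apply/funext => x; rewrite big_ord0.
rewrite big_ord_recr /= -mN -meanD //.
rewrite (_ : (fun x => _) = fun x => \sum_(k < N) F k x + F N x).
  by split => //; cont.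
by apply/funext => x; rewrite big_ord_recr.
Qed.

Lemma mean_cosn n : mean (@cosn R n) = (n == 0)%:R.
Proof.
have [->|n0] := eqVneq n 0.
  rewrite (_ : cosn 0 = fun=> 1) ?mean_cst //.
  by apply/funext => x; rewrite /cosn mulr0z mulr0 mul0r cos0.
have w0 : 2 * pi * n%:~R != 0 :> R.
  by rewrite !mulf_neq0 ?pnatr_eq0 ?intr_eq0 // gt_eqF // pi_gt0.
have H x : is_derive x (1 : R) (fun y => (2 * pi * n%:~R)^-1 * sinn n y) (cosn n x).
  apply: (is_derive_eq (derM (der_cst _ x) (der_sinn n x))).
  by rewrite mul0r add0r mulKf.
rewrite (mean_der0 H) //; first exact: cont_cosn.
by move=> x; rewrite sinn_periodic.
Qed.

Lemma mean_sinn n : mean (@sinn R n) = 0.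
Proof.
have [->|n0] := eqVneq n 0.
  rewrite (_ : sinn 0 = fun=> 0) ?mean_cst //.
  by apply/funext => x; rewrite /sinn mulr0z mulr0 mul0r sin0.
have w0 : 2 * pi * n%:~R != 0 :> R.
  by rewrite !mulf_neq0 ?pnatr_eq0 ?intr_eq0 // gt_eqF // pi_gt0.
have H x : is_derive x (1 : R) (fun y => - (2 * pi * n%:~R)^-1 * cosn n y) (sinn n x).
  apply: (is_derive_eq (derM (der_cst _ x) (der_cosn n x))).
  by rewrite mul0r add0r !mulNr mulrN opprK mulKf.
rewrite (mean_der0 H) //; first exact: cont_sinn.
by move=> x; rewrite cosn_periodic.
Qed.

Lemma trig_products (m n : int) x :
  [/\ cosn m x * cosn n x = 2^-1 * (cosn (m - n) x + cosn (m + n) x),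
      sinn m x * sinn n x = 2^-1 * (cosn (m - n) x - cosn (m + n) x)
    & sinn m x * cosn n x = 2^-1 * (sinn (m - n) x + sinn (m + n) x)].
Proof.
have E1 : 2 * pi * (m - n)%:~R * x = 2 * pi * m%:~R * x - 2 * pi * n%:~R * x.
  by rewrite intrB; ring.
have E2 : 2 * pi * (m + n)%:~R * x = 2 * pi * m%:~R * x + 2 * pi * n%:~R * x.
  by rewrite intrD; ring.
rewrite /cosn /sinn E1 E2.
by split; rewrite ?cosB ?sinB ?cosD ?sinD; field.
Qed.

Lemma trig_orthogonality (m n : int) :
  [/\ mean (fun x : R => cosn m x * cosn n x) = 2^-1 * ((m == n)%:R + (m == - n)%:R),
      mean (fun x : R => sinn m x * sinn n x) = 2^-1 * ((m == n)%:R - (m == - n)%:R)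
    & mean (fun x : R => sinn m x * cosn n x) = 0].
Proof.
have cc k := @cont_cosn R k; have cs k := @cont_sinn R k.
have e1 : (m == n) = (m - n == 0) by rewrite subr_eq0.
have e2 : (m == - n) = (m + n == 0) by rewrite addr_eq0.
split.
- rewrite e1 e2 -!mean_cosn -meanD // -meanZ; last by cont.
  by congr mean; apply/funext => x; have [->] := trig_products m n x.
- rewrite e1 e2 -!mean_cosn -meanB // -meanZ; last by cont.
  by congr mean; apply/funext => x; have [_ ->] := trig_products m n x.
- transitivity (2^-1 * (mean (@sinn R (m - n)) + mean (@sinn R (m + n)))).
    rewrite -meanD // -meanZ; last by cont.
    by congr mean; apply/funext => x; have [_ _ ->] := trig_products m n x.
  by rewrite !mean_sinn addr0 mulr0.
Qed.

(** The series converges uniformly by the Weierstrass test, so it can be integrated termwise against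
    each mode. The sine coefficient of index 0 cannot be prescribed, since sin (0 x) = 0. *)
Lemma trig_series (A B : nat -> R) (C : R) :
  (forall N : nat, \sum_(k < N) (`|A k| + `|B k|) <= C) ->
  exists g, [/\ continuous g, periodic g 1,
    forall n : nat, fourier_cos g n = A n,
    forall n : nat, (0 < n)%N -> fourier_sin g n = B n
  & forall x, `|g x| <= 2 * C].
Proof.
move=> HC.
(* The squares of the modes have mean 1/2 except for the constant one, whose mean is 1;
   equivalently, the factor 2 accounts for the negative frequencies. *)
pose lam (k : nat) : R := if k == 0%N then 1 else 2.
pose a (k : nat) (x : R) := lam k * (A k * cosn k x + B k * sinn k x).
pose b (k : nat) : R := 2 * (`|A k| + `|B k|).
have b0 k : 0 <= b k by rewrite mulr_ge0 // addr_ge0.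
have ab k x : `|a k x| <= b k.
  rewrite normrM ler_pM //.
    by rewrite /lam; case: eqP => _; rewrite ger0_norm // ler1n.
  apply: le_trans (ler_normD _ _) _; rewrite !normrM lerD //.
    by rewrite -[leRHS]mulr1 ler_wpM2l // cos_max.
  by rewrite -[leRHS]mulr1 ler_wpM2l // sin_max.
have ca k : continuous (a k).
  have cc := @cont_cosn R k; have cs := @cont_sinn R k.
  by rewrite /a; cont.
have pa k : periodic (a k) 1.
  by move=> x; rewrite /a cosn_periodic sinn_periodic.
pose P (N : nat) x := \sum_(k < N) a k x.
pose S (N : nat) := \sum_(k < N) b k.
have SC N : S N <= 2 * C by rewrite /S -mulr_sumr ler_wpM2l.
have ndS : nondecreasing_seq S.
  apply/nondecreasing_seqP => N; rewrite /S big_ord_recr /= lerDl //.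
pose Sl := sup (range S).
have ubS : has_ubound (range S) by exists (2 * C) => _ [N _ <-].
have cS : S @ \oo --> Sl by exact: nondecreasing_cvgn.
have SSl N : S N <= Sl by apply: ub_le_sup => //; exists N.
have SlC : Sl <= 2 * C.
  by apply: ge_sup; [exists (S 0%N), 0%N | move=> _ [N _ <-]].
have PP x (N j : nat) : `|P (N + j)%N x - P N x| <= S (N + j)%N - S N.
  elim: j => [|j IH]; first by rewrite addn0 !subrr normr0.
  rewrite addnS /P /S !big_ord_recr /=.
  have := ab (N + j)%N x; move: IH; rewrite -/(P _ _) -/(S _).
  have := ler_normD (P (N + j)%N x - P N x) (a (N + j)%N x).
  by rewrite addrAC /P /S; lra.
have cP x : exists l : R, (P ^~ x) @ \oo --> l.
  (* Adding the partial sums of the majorant makes the sequence nondecreasing and bounded, so that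
     [P = V - S] is a difference of two convergent monotone sequences. *)
  pose V N := P N x + S N.
  have cV : V @ \oo --> sup (range V).
    apply: nondecreasing_cvgn.
      apply/nondecreasing_seqP => N; rewrite /V /P /S !big_ord_recr /=.
      have := ab N x; rewrite ler_norml => /andP[h _]; lra.
    exists (4 * C) => _ [N _ <-].
    have := PP x 0%N N; rewrite add0n /V {2}/P {2}/S !big_ord0 !subr0.
    by rewrite ler_norml => /andP[_ h]; have := SC N; lra.
  exists (sup (range V) - Sl).
  rewrite (_ : P ^~ x = fun N => V N - S N); first exact: cvgB.
  by apply/funext => N; rewrite /V addrK.
have [g Hg] := choice cP.
have gP x N : `|g x - P N x| <= Sl - S N.
  apply/ler_addgt0Pl => e e0.
  have /cvgrPdist_le /(_ e e0) [M _ HM] := Hg x.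
  have := HM (N + M)%N (leq_addl _ _) => h1.
  have h2 := PP x N M; have h3 := SSl (N + M)%N.
  have := ler_distD (P (N + M)%N x) (g x) (P N x); lra.
have tail e : 0 < e -> exists N, forall j, (N <= j)%N -> Sl - S j <= e.
  move=> e0; have /cvgrPdist_le /(_ e e0) [M _ HM] := cS.
  by exists M => j Mj; apply: le_trans (ler_norm _) (HM j Mj).
have cg : continuous g.
  move=> x; apply/cvgrPdist_le => e e0.
  have e3 : 0 < e / 3 by rewrite divr_gt0.
  have [N /(_ N (leqnn _)) HN] := tail _ e3.
  have [cPN _] := mean_sum N ca.
  have /cvgrPdist_le /(_ _ e3) := cPN x.
  apply: filterS => y h; have h1 := gP x N; have h2 := gP y N.
  have := ler_distD (P N x) (g x) (g y).
  have := ler_distD (P N y) (P N x) (g y).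
  by rewrite (distrC (P N y)) /P in h h1 h2 * ; lra.
(* Termwise integration: the means of [g T] and of [P N T] differ by at most the uniform tail, and
   the latter is constant for large [N]. *)
have coefP (T : R -> R) (l : nat -> R) : continuous T -> (forall x, `|T x| <= 1) ->
    (exists N0, forall N, (N0 <= N)%N -> mean (fun x => P N x * T x) = l 0%N) ->
    mean (fun x => g x * T x) = l 0%N.
  move=> cT T1 [N0 HN0]; apply/eqP; rewrite -subr_eq0 -normr_le0.
  apply/ler_addgt0Pl => e e0; rewrite addr0.
  have [N1 HN1] := tail _ e0.
  pose N := maxn N0 N1.
  have [cPN _] := mean_sum N ca.
  rewrite -(HN0 N (leq_maxl _ _)) -meanB; [|by rewrite /P; cont..].
  apply: mean_abs_le; first by rewrite /P; cont.
  move=> x; rewrite -mulrBl normrM -[leRHS]mulr1 ler_pM //.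
  by apply: le_trans (gP x N) _; apply: HN1; exact: leq_maxr.
have meanP (T : R -> R) N : continuous T -> mean (fun x => P N x * T x) =
    \sum_(k < N) lam k * (A k * mean (fun x => cosn k x * T x) +
                           B k * mean (fun x => sinn k x * T x)).
  move=> cT.
  have cc (k : nat) := @cont_cosn R k; have cs (k : nat) := @cont_sinn R k.
  pose F (k : nat) x := lam k * (A k * (cosn k x * T x) + B k * (sinn k x * T x)).
  have cF k : continuous (F k) by have := cc k; have := cs k => ? ?; rewrite /F; cont.
  have [_ EF] := mean_sum N cF.
  transitivity (\sum_(k < N) mean (F k)); last first.
    apply: eq_bigr => k _; have := cc k; have := cs k => ? ?.
    by rewrite /F meanZ ?meanD ?meanZ //; cont.
  rewrite -EF.
  congr mean; apply/funext => x; rewrite /P mulr_suml; apply: eq_bigr => k _.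
  by rewrite /a /F; ring.
have eqz (m n : nat) : (Posz m == Posz n) = (m == n) by [].
have eqzN (m n : nat) : (Posz m == - Posz n) = (m == 0%N) && (n == 0%N).
  by case: n => [|n]; [rewrite oppr0 andbT | rewrite -NegzE andbF].
exists g; split => //.
- move=> x; apply/eqP; rewrite -subr_eq0 -normr_le0; apply/ler_addgt0Pl => e e0.
  have e2 : 0 < e / 2 by rewrite divr_gt0.
  have [N /(_ N (leqnn _)) HN] := tail _ e2.
  have := gP x N; have := gP (x + 1) N.
  have -> : P N (x + 1) = P N x by apply: eq_bigr => k _; rewrite pa.
  have := ler_distD (P N x) (g (x + 1)) (g x); rewrite (distrC (g x)); lra.
- move=> n; rewrite fourier_cosE; apply: (coefP _ (fun=> A n)).
  + exact: cont_cosn.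
  + by move=> x; exact: cos_max.
  + exists n.+1 => N nN; rewrite meanP; last exact: cont_cosn.
    rewrite (bigD1 (Ordinal nN)) //= big1 ?addr0 => [|k kn].
      have [-> _ ->] := trig_orthogonality n n; rewrite eqxx eqzN andbb /lam.
      by case: eqP => _ /=; field.
    have [-> _ ->] := trig_orthogonality k n; rewrite eqz eqzN.
    have /negPf kn' : (k : nat) != n by apply: contra kn => /eqP E; apply/eqP/val_inj.
    have : ((k : nat) == 0%N) && (n == 0%N) = false.
      by apply/negP => /andP[/eqP k0 /eqP n0]; rewrite k0 n0 eqxx in kn'.
    by move=> ->; rewrite kn' /=; ring.
- move=> n n0; rewrite fourier_sinE; apply: (coefP _ (fun=> B n)).
  + exact: cont_sinn.
  + by move=> x; exact: sin_max.
  + exists n.+1 => N nN; rewrite meanP; last exact: cont_sinn.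
    have n00 : (n == 0%N) = false by rewrite gtn_eqF.
    have cs0 (k m : nat) : mean (fun x : R => cosn k x * sinn m x) = 0.
      have [_ _ <-] := trig_orthogonality m k; congr mean.
      by apply/funext => x; rewrite mulrC.
    rewrite (bigD1 (Ordinal nN)) //= big1 ?addr0 => [|k kn].
      have [_ -> _] := trig_orthogonality n n; rewrite cs0 eqxx eqzN /lam n00.
      by rewrite /=; field.
    have [_ -> _] := trig_orthogonality k n; rewrite cs0 eqz eqzN n00 andbF.
    have /negPf kn' : (k : nat) != n by apply: contra kn => /eqP E; apply/eqP/val_inj.
    by rewrite kn' /=; ring.
- move=> x; have := gP x 0%N; rewrite /P /S !big_ord0 !subr0; lra.
Qed.

End TrigSeries.

(** * Sup bounds and classical derivatives from Sobolev norms *)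

Section Embedding.
Context {R : realType}.
Implicit Types (f g : R -> R) (n : int) (x s e : R).

Lemma fourier_opp f n : continuous f ->
  fourier_cos f (- n) = fourier_cos f n /\ fourier_sin f (- n) = - fourier_sin f n.
Proof.
move=> cf; have cs := @cont_sinn R n; rewrite !fourier_cosE !fourier_sinE; split.
  by congr mean; apply/funext => x; rewrite /cosn intrN mulrN mulNr cosN.
rewrite -meanN; last by cont.
by congr mean; apply/funext => x; rewrite /sinn intrN mulrN mulNr sinN mulrN.
Qed.

(** Nonnegative frequencies suffice: the negative ones follow by parity, and the sine coefficient of
    index 0 is 0 for every function. The hypotheses thus match what [trig_series] delivers. *)
Lemma fourier_ext f g : continuous f -> continuous g ->
  periodic f 1 -> periodic g 1 ->
  (forall n : nat, fourier_cos f n = fourier_cos g n) ->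
  (forall n : nat, (0 < n)%N -> fourier_sin f n = fourier_sin g n) -> f = g.
Proof.
move=> cf cg pf pg Ec Es; apply/funext => x; apply/eqP; rewrite -subr_eq0; apply/eqP.
apply: (@fourier_trivial_eq0 R (fun y => f y - g y)); first by cont.
  by move=> y; rewrite pf pg.
have Es' (n : nat) : fourier_sin f n = fourier_sin g n.
  case: n => [|n]; last exact: Es.
  have E (h : R -> R) : fourier_sin h 0 = 0 :> R.
    rewrite fourier_sinE -[RHS](mean_cst (0 : R)); congr mean.
    by apply/funext => y; rewrite /sinn mulr0z mulr0 mul0r sin0 mulr0.
  by rewrite !E.
have H (n : nat) : fourier_cos (fun y => f y - g y) n = 0 /\
                   fourier_sin (fun y => f y - g y) n = 0.
  have cc := @cont_cosn R n; have cs := @cont_sinn R n.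
  rewrite fourier_cosE fourier_sinE; split.
    rewrite (_ : (fun x => _) = fun x => f x * cosn n x - g x * cosn n x).
      by rewrite meanB; [rewrite -!fourier_cosE Ec subrr | cont..].
    by apply/funext => y; rewrite mulrBl.
  rewrite (_ : (fun x => _) = fun x => f x * sinn n x - g x * sinn n x).
    by rewrite meanB; [rewrite -!fourier_sinE Es' subrr | cont..].
  by apply/funext => y; rewrite mulrBl.
case=> n; first exact: H.
rewrite NegzE; have [|-> ->] := @fourier_opp (fun y => f y - g y) n.+1; first by cont.
by have [-> ->] := H n.+1; rewrite oppr0.
Qed.

(** The sum of the Fourier series of [f], whose coefficients are absolutely summable, satisfies the
    bound; by uniqueness it is [f] itself. *)
Lemma sobolev_sup_bound s : 2^-1 < s -> exists2 C : R, 0 < C &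
  forall f e, 0 < e -> continuous f -> periodic f 1 ->
    (sobolev_norm s f <= e%:E)%E -> forall x, `|f x| <= C * e.
Proof.
move=> s2; have [C C0 HC] := coef_sum_bound s2.
exists (2 * C); first by rewrite mulr_gt0.
move=> f e e0 cf pf fe x.
have H := HC (fun k => fourier_cos f k) (fun k => fourier_sin f k) e e0 (fun N =>
  sobolev_norm_energy N (ltW e0) fe).
have [g [cg pg Ec Es Hg]] := @trig_series R (fun k => fourier_cos f k)
  (fun k => fourier_sin f k) _ H.
have -> : f = g.
  by apply: fourier_ext => // n n0; rewrite Es.
by rewrite -mulrA.
Qed.

(** A derivative multiplies the squared coefficients by (2 pi n)^2, which costs one unit of
    regularity. *)
Lemma weight_pred s n : 1 <= s ->
  weight (s - 1) n * (2 * pi * n%:~R) ^+ 2 <= weight s n.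
Proof.
move=> s1; rewrite /weight; set W := 1 + _.
have W0 : 0 < W by rewrite /W ltr_pwDl // sqr_ge0.
have -> : powR W s = powR W (s - 1) * W.
  rewrite -[X in _ * X](powRr1 (ltW W0)) -powRD ?subrK //.
  by apply/implyP => _; rewrite gt_eqF.
by rewrite ler_wpM2l ?powR_ge0 // /W lerDr.
Qed.

Lemma fourier_derivative f g n : (forall x, is_derive x (1 : R) f (g x)) ->
  continuous g -> periodic f 1 ->
  fourier_cos g n = 2 * pi * n%:~R * fourier_sin f n /\
  fourier_sin g n = - (2 * pi * n%:~R * fourier_cos f n).
Proof.
move=> df cg pf; rewrite !fourier_cosE !fourier_sinE.
have cf := der_continuous df.
have cc := @cont_cosn R n; have cs := @cont_sinn R n; split.
  have c1 : continuous (fun x => - (2 * pi * n%:~R) * sinn n x) by cont.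
  rewrite -[LHS]opprK -(mean_by_parts df (der_cosn n) cg c1 pf (cosn_periodic n)).
  rewrite -meanN -?meanZ; [|by cont..].
  by congr mean; apply/funext => x; ring.
have c1 : continuous (fun x => 2 * pi * n%:~R * cosn n x) by cont.
rewrite -[LHS]opprK -(mean_by_parts df (der_sinn n) cg c1 pf (sinn_periodic n)).
rewrite -?meanZ; [|by cont..].
by congr (- _); congr mean; apply/funext => x; ring.
Qed.

(** The formally differentiated Fourier series is absolutely summable because s - 1 > 1/2. Its sum
    [g] is integrated, and uniqueness of the coefficients identifies [f] with the primitive up to a
    constant. *)
Lemma sobolev_derivable s f : 3 / 2 < s -> sobolev s f ->
  exists g, [/\ forall x, is_derive x (1 : R) f (g x), sobolev (s - 1) g
    & (sobolev_norm (s - 1) g <= sobolev_norm s f)%E].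
Proof.
move=> s32 [pf cf foo].
have [e e0 fe] : exists2 e : R, 0 < e & (sobolev_norm s f <= e%:E)%E.
  have f0 : (0 <= sobolev_norm s f)%E by exact: poweR_ge0.
  exists (fine (sobolev_norm s f) + 1).
    by rewrite ltr_wpDl // fine_ge0.
  rewrite EFinD fineK ?ge0_fin_numE // leeDl //.
pose w (k : nat) : R := 2 * pi * (k : int)%:~R.
(* The coefficients that an integration by parts would give to the derivative of [f]. *)
pose A k := w k * fourier_sin f k; pose B k := - (w k * fourier_cos f k).
have s1 : 2^-1 < s - 1 by lra.
have [C C0 HC] := coef_sum_bound s1.
have HE (N : nat) : \sum_(k < N) weight (s - 1) k * (A k ^+ 2 + B k ^+ 2) <= e ^+ 2.
  apply: le_trans (sobolev_norm_energy N (ltW e0) fe); apply: ler_sum => k _.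
  have s1' : 1 <= s by lra.
  have -> : weight (s - 1) k * (A k ^+ 2 + B k ^+ 2) = weight (s - 1) k * w k ^+ 2
      * (fourier_cos f k ^+ 2 + fourier_sin f k ^+ 2) by rewrite /A /B; ring.
  by apply: ler_wpM2r; [rewrite addr_ge0 // sqr_ge0 | exact: weight_pred].
have [g [cg pg Ec Es Hg]] := @trig_series R A B _ (HC A B e e0 HE).
have [h [h0 dh]] := primitive_exists cg.
have ch := der_continuous dh.
(* The increment of [h] over a period is the mean of [g], that is [A 0 = 0]. *)
have ph : periodic h 1.
  have d0 x : is_derive x (1 : R) (fun y => h (y + 1) - h y) 0.
    have d1 : is_derive x (1 : R) (fun y : R => y + 1) 1.
      exact: (is_derive_eq (derD (der_id x) (der_cst 1 x)) (addr0 _)).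
    have d2 := @der_comp R h (fun y => y + 1) x _ _ (dh (x + 1)) d1.
    apply: (is_derive_eq (derD d2 (derN (dh x)))).
    by rewrite pg mulr1 subrr.
  move=> x; have := der0_cst d0 x 0; rewrite add0r -(mean_FTC dh cg).
  have -> : mean g = 0.
    have := Ec 0%N; rewrite /A /w mulr0z mulr0 mul0r => <-; rewrite fourier_cosE.
    by congr mean; apply/funext => y; rewrite /cosn mulr0z mulr0 mul0r cos0 mulr1.
  by move/eqP; rewrite subr_eq0 => /eqP.
(* The constant of integration is read off at frequency zero, the only one at which [g] says nothing
   about [f]. *)
pose c := fourier_cos f 0 - fourier_cos h 0.
have fh : f = fun x => h x + c.
  have coefh (n : int) : fourier_cos (fun x => h x + c) n =
       fourier_cos h n + c * (n == 0)%:R /\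
       fourier_sin (fun x => h x + c) n = fourier_sin h n.
    have cc := @cont_cosn R n; have cs := @cont_sinn R n.
    rewrite !fourier_cosE !fourier_sinE; split.
      rewrite -(mean_cosn n) -meanZ // -meanD; [|by cont..].
      by congr mean; apply/funext => x; rewrite mulrDl.
    transitivity (mean (fun x => h x * sinn n x) + c * mean (@sinn R n)); last first.
      by rewrite mean_sinn mulr0 addr0.
    rewrite -meanZ // -meanD; [|by cont..].
    by congr mean; apply/funext => x; rewrite mulrDl.
  apply: fourier_ext => //; first by cont.
  - by move=> x; rewrite ph.
  - move=> n; rewrite (coefh n).1; have [->|n0] := eqVneq n 0%N.
      by rewrite eqxx mulr1 /c; ring.
    have [_ E1] := fourier_derivative n dh cg ph.
    have n1 : (0 < n)%N by rewrite lt0n.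
    have wn : w n != 0 by rewrite !mulf_neq0 ?pnatr_eq0 ?intr_eq0 // gt_eqF // pi_gt0.
    move: E1; rewrite (Es _ n1) /B => /oppr_inj; rewrite -/(w n) => /(mulfI wn) ->.
    by rewrite (_ : (Posz n == 0) = false) ?mulr0 ?addr0 //; apply/negbTE.
  - move=> n n1; rewrite (coefh n).2.
    have [E1 _] := fourier_derivative n dh cg ph.
    have n0 : n != 0%N by rewrite -lt0n.
    have wn : w n != 0 by rewrite !mulf_neq0 ?pnatr_eq0 ?intr_eq0 // gt_eqF // pi_gt0.
    by move: E1; rewrite (Ec n) /A -/(w n) => /(mulfI wn) ->.
have df x : is_derive x (1 : R) f (g x).
  by rewrite fh; exact: (is_derive_eq (derD (dh x) (der_cst c x)) (addr0 _)).
have ng : (sobolev_norm (s - 1) g <= sobolev_norm s f)%E.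
  have pos t (k : R -> R) (n : int) : (0 <= (weight t n * (fourier_cos k n ^+ 2 +
    fourier_sin k n ^+ 2))%:E)%E.
    by rewrite lee_fin mulr_ge0 // ?(ltW (weight_gt0 _ _)) // addr_ge0 // sqr_ge0.
  apply: gt0_ler_poweR => //.
  - by rewrite /= in_itv /= leey andbT; apply: esum_ge0 => n _; exact: pos.
  - by rewrite /= in_itv /= leey andbT; apply: esum_ge0 => n _; exact: pos.
  apply: le_esum => n _; rewrite lee_fin.
  have [-> ->] := fourier_derivative n df cg pf.
  have s1' : 1 <= s by lra.
  rewrite -/(weight (s - 1) n) -/(weight s n).
  rewrite (_ : weight (s - 1) n * _ = weight (s - 1) n * (2 * pi * n%:~R) ^+ 2
      * (fourier_cos f n ^+ 2 + fourier_sin f n ^+ 2)); last by ring.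
  by apply: ler_wpM2r; [rewrite addr_ge0 // sqr_ge0 | exact: weight_pred].
exists g; split => //; split => //.
by apply: le_lt_trans ng foo.
Qed.

End Embedding.

(** * The equation at a fixed time *)

Lemma freq_neq0 (R : realType) (n : nat) : n != 0%N -> 2 * pi * n%:~R != 0 :> R.
Proof.
by move=> n0; rewrite !mulf_neq0 ?pnatr_eq0 ?intr_eq0 // gt_eqF // pi_gt0.
Qed.

Lemma trig_test_function (R : realType) (n : int) :
  test_function (@cosn R n) /\ test_function (@sinn R n).
Proof.
(* Differentiation exchanges the two modes, so the induction runs over their span. *)
suff H (f : R -> R) (a b : R) : f = (fun x => a * cosn n x + b * sinn n x) ->
    forall (k : nat) (x : R), derivable (derive1n k f) x 1.
  split; split; [exact: cosn_periodic| |exact: sinn_periodic|].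
    by apply: (H _ 1 0); apply/funext => x; rewrite mul1r mul0r addr0.
  by apply: (H _ 0 1); apply/funext => x; rewrite mul1r mul0r add0r.
have D (c d : R) x : is_derive x (1 : R) (fun x => c * cosn n x + d * sinn n x)
    (2 * pi * n%:~R * d * cosn n x + - (2 * pi * n%:~R * c) * sinn n x).
  apply: (is_derive_eq (derD (derM (der_cst c x) (der_cosn n x))
                             (derM (der_cst d x) (der_sinn n x)))).
  ring.
move=> fE k; suff [c [d ->]] : exists c d : R,
    derive1n k f = fun x => c * cosn n x + d * sinn n x.
  by move=> x; exact: ex_derive.
elim: k => [|k [c [d IH]]]; first by exists a, b.
exists (2 * pi * n%:~R * d), (- (2 * pi * n%:~R * c)).
by rewrite derive1nS IH; apply/funext => x; apply: is_derive_derive1.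
Qed.

Section FixedTime.
Context {R : realType} (k1 k2 : R) (u W Z : R -> R).
Hypothesis du : forall x, is_derive x (1 : R) u (W x).
Hypothesis dW : forall x, is_derive x (1 : R) W (Z x).
Hypothesis cZ : continuous Z.
Hypothesis pu : periodic u 1.
Hypothesis pW : periodic W 1.
Hypothesis pZ : periodic Z 1.

Let mu := mean u.
Let E := mean (fun x => W x ^+ 2).
Let cu : continuous u := der_continuous du.
Let cW : continuous W := der_continuous dW.

(** The equation in divergence form is m_t + flux_x = 0, with W = u_x, Z = u_xx and m = mu - Z. The
    nonconservative part is an exact derivative: 2 m u_x + u m_x = (u m)_x + m u_x, and m u_x = (mu
    u - u_x^2 / 2)_x. *)
Definition flux x := k1 * ((2 * mu * u x - W x ^+ 2) * (mu - Z x))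
  + k2 * (u x * (mu - Z x) + mu * u x - 2^-1 * W x ^+ 2).

Lemma cont_flux : continuous flux.
Proof. by rewrite /flux; cont. Qed.

Lemma derive1_uE : derive1 u = W.
Proof. by apply/funext => x; apply: is_derive_derive1. Qed.

Lemma momentumE x : momentum u x = mu - Z x.
Proof.
rewrite /momentum derive1nS /= derive1_uE; congr (_ - _).
exact: is_derive_derive1.
Qed.

Ltac der0 := der ltac:(first [exact: du | exact: dW]).

(** Up to an exact derivative [q], which absorbs every term containing u_xx, the flux is a
    combination of u and u_x^2; its mean therefore involves only the conserved quantities. *)
Lemma mean_flux : mean flux =
  k1 * (2 * mu ^+ 3 + mu * E) + k2 * (2 * mu ^+ 2 + 2^-1 * E).
Proof.
pose Q x := k1 * (- (2 * mu) * (u x * W x) + 3^-1 * (W x * W x ^+ 2)) + - (k2 * (u x *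
  W x)).
pose q x := k1 * (- (2 * mu) * (W x * W x + u x * Z x) + W x ^+ 2 * Z x)
            + - (k2 * (W x * W x + u x * Z x)).
have dQ x : is_derive x (1 : R) Q (q x).
  by rewrite /Q; eapply is_derive_eq; [der0 | rewrite /q /=; field].
have cq : continuous q by rewrite /q; cont.
have pQ : periodic Q 1 by move=> y; rewrite /Q pu pW.
have := mean_der0 dQ cq pQ.
have -> : flux = fun x => q x + ((2 * k1 * mu ^+ 2 + 2 * k2 * mu) * u x +
                       (k1 * mu + 2^-1 * k2) * W x ^+ 2).
  by apply/funext => x; rewrite /flux /q; field.
have cW2 : continuous (fun x => W x ^+ 2) by cont.
have c1 : continuous (fun x => (2 * k1 * mu ^+ 2 + 2 * k2 * mu) * u x) by cont.
have c2 : continuous (fun x => (k1 * mu + 2^-1 * k2) * W x ^+ 2) by cont.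
move=> q0; rewrite (meanD cq (contD c1 c2)) (meanD c1 c2) (meanZ _ cu) (meanZ _ cW2).
by rewrite q0 -/mu -/E; field.
Qed.

(** The product is the derivative of the periodic function [P]. Conservation of the integral of
    u_x^2 rests on this identity. *)
Lemma mean_flux_W : mean (fun x => W x * flux x) = 0.
Proof.
pose P x := k1 * (mu ^+ 2 * u x ^+ 2 + - (mu * (u x * W x ^+ 2)) + 4^-1 * (W x ^+ 2) ^+ 2)
  + k2 * (mu * u x ^+ 2 + - (2^-1 * (u x * W x ^+ 2))).
apply: (@mean_der0 R P).
- by move=> x; rewrite /P; eapply is_derive_eq; [der0 | rewrite /flux /=; field].
- by have := cont_flux => ?; cont.
- by move=> x; rewrite /P pu pW.
Qed.

Lemma mean_W : mean W = 0.
Proof. exact: mean_der0 du cW pu. Qed.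

Section Reduced.
Context (v vx : R -> R).
Hypothesis dv : forall x, is_derive x (1 : R) v (vx x).
Hypothesis cvx : continuous vx.
Hypothesis pv : periodic v 1.
Hypothesis pvx : periodic vx 1.
Hypothesis Heq : equation_at k1 k2 u v.
Let cv : continuous v := der_continuous dv.

(** Integrating by parts once, in v and in the term m u_x, leaves the test function present only
    through its first derivative, apart from the term in [mean v]. *)
Lemma equation_reduced phi phi1 phi2 : test_function phi ->
  (forall x, is_derive x (1 : R) phi (phi1 x)) ->
  (forall x, is_derive x (1 : R) phi1 (phi2 x)) -> continuous phi2 ->
  periodic phi1 1 ->
  mean v * mean phi + mean (fun x => (vx x - flux x) * phi1 x) = 0.
Proof.
move=> tp d1 d2 c2 p1; have [p0 _] := tp; have := Heq tp.
have c1 := der_continuous d2; have c0 := der_continuous d1.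
have E1 : derive1 phi = phi1 by apply/funext => x; exact: is_derive_derive1.
have E2 : derive1n 2 phi = phi2.
  by apply/funext => x; rewrite derive1nS /= E1; exact: is_derive_derive1.
have E3 : derive1 (fun y => u y * phi y) = fun x => W x * phi x + u x * phi1 x.
  by apply/funext => x; apply: is_derive_derive1; exact: derM.
have Em : momentum u = fun x => mu - Z x by apply/funext => x; exact: momentumE.
rewrite Em E1 E2 E3 derive1_uE -/mu.
have I1 := mean_by_parts dv d2 cvx c2 pv p1.
(* A primitive of m u_x, which is what remains of 2 m u_x phi - m (u phi)_x once the term - m u
   phi_x is set aside. *)
pose G x := mu * u x + - (2^-1 * W x ^+ 2).
pose g x := mu * W x + - (W x * Z x).
have dG x : is_derive x (1 : R) G (g x).
  by rewrite /G; eapply is_derive_eq; [der0 | rewrite /g /=; field].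
have cg : continuous g by rewrite /g; cont.
have cG := der_continuous dG.
have pG : periodic G 1 by move=> x; rewrite /G pu pW.
have I2 := mean_by_parts dG d1 cg c1 pG p0.
have cF := cont_flux.
have c01 : continuous (fun x => mean v * phi x) by cont.
have c02 : continuous (fun x => v x * phi2 x) by cont.
have c03 : continuous (fun x => vx x * phi1 x) by cont.
have c04 : continuous (fun x => g x * phi x) by cont.
have c05 : continuous (fun x => G x * phi1 x) by cont.
have c06 : continuous (fun x => (2 * mu * u x - W x ^+ 2) * (mu - Z x) * phi1 x) by cont.
have c07 : continuous (fun x => 2 * (mu - Z x) * W x * phi x) by cont.
have c08 : continuous (fun x => (mu - Z x) * (W x * phi x + u x * phi1 x)) by cont.
have c09 : continuous (fun x => u x * (mu - Z x) * phi1 x) by cont.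
have -> : mean (fun x => (vx x - flux x) * phi1 x) =
    mean (fun x => vx x * phi1 x)
    - k1 * mean (fun x => (2 * mu * u x - W x ^+ 2) * (mu - Z x) * phi1 x)
    - k2 * (mean (fun x => u x * (mu - Z x) * phi1 x) + mean (fun x => G x * phi1 x)).
  rewrite (_ : (fun x => _) = fun x => vx x * phi1 x
      - (k1 * ((2 * mu * u x - W x ^+ 2) * (mu - Z x) * phi1 x)
         + k2 * (u x * (mu - Z x) * phi1 x + G x * phi1 x))); last first.
    by apply/funext => x; rewrite /flux /G; ring.
  have c10 := contM (@cont_cst _ _ k1) c06.
  have c11 := contM (@cont_cst _ _ k2) (contD c09 c05).
  rewrite (meanB c03 (contD c10 c11)) (meanD c10 c11) (meanZ k1 c06).
  rewrite (meanZ k2 (contD c09 c05)) (meanD c09 c05); ring.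
have -> : mean (fun x => 2 * (mu - Z x) * W x * phi x)
    - mean (fun x => (mu - Z x) * (W x * phi x + u x * phi1 x)) =
    mean (fun x => g x * phi x) - mean (fun x => u x * (mu - Z x) * phi1 x).
  rewrite -(meanB c07 c08) -(meanB c04 c09).
  by congr mean; apply/funext => x; rewrite /g; ring.
rewrite (meanB c01 c02) (meanZ _ c0) I1 I2; lra.
Qed.

(** The constant test function gives the first claim. The other modes show that v_x and the flux
    share all their coefficients of nonzero frequency, and the remaining constant is fixed because
    v_x has mean 0. *)
Lemma velocity_gradient : mean v = 0 /\ forall x, vx x = flux x - mean flux.
Proof.
have cF := cont_flux.
have cc n := @cont_cosn R n; have cs n := @cont_sinn R n.
have Hc n : mean v * mean (@cosn R n) - 2 * pi * n%:~R * mean (fun x => (vx x - flux x)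
  * sinn n x) = 0.
  have [t _] := trig_test_function R n.
  have d2 x : is_derive x (1 : R) (fun x => - (2 * pi * n%:~R) * sinn n x)
      (- (2 * pi * n%:~R) * (2 * pi * n%:~R * cosn n x)).
    by apply: (is_derive_eq (derM (der_cst _ x) (der_sinn n x))); ring.
  have := equation_reduced t (der_cosn n) d2.
  have H1 : continuous (fun x : R => - (2 * pi * n%:~R) * (2 * pi * n%:~R * cosn n x)).
    by have := cc n => ?; cont.
  have H2 : periodic (fun x : R => - (2 * pi * n%:~R) * sinn n x) 1.
    by move=> x; rewrite sinn_periodic.
  have cVF : continuous (fun x => (vx x - flux x) * sinn n x) by have := cs n => ?; cont.
  move=> /(_ H1 H2) <-; congr (_ + _); rewrite -mulNr -(meanZ _ cVF).
  by congr mean; apply/funext => x; ring.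
have Hs n : 2 * pi * n%:~R * mean (fun x => (vx x - flux x) * cosn n x) = 0.
  have [_ t] := trig_test_function R n.
  have d2 x : is_derive x (1 : R) (fun x => (2 * pi * n%:~R) * cosn n x)
      ((2 * pi * n%:~R) * (- (2 * pi * n%:~R) * sinn n x)).
    by apply: (is_derive_eq (derM (der_cst _ x) (der_cosn n x))); ring.
  have := equation_reduced t (der_sinn n) d2.
  rewrite mean_sinn mulr0 add0r.
  have H1 : continuous (fun x : R => (2 * pi * n%:~R) * (- (2 * pi * n%:~R) * sinn n x)).
    by have := cs n => ?; cont.
  have H2 : periodic (fun x : R => (2 * pi * n%:~R) * cosn n x) 1.
    by move=> x; rewrite cosn_periodic.
  have cVF : continuous (fun x => (vx x - flux x) * cosn n x) by have := cc n => ?; cont.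
  move=> /(_ H1 H2) <-; rewrite -(meanZ _ cVF).
  by congr mean; apply/funext => x; ring.
have v0 : mean v = 0.
  by have := Hc 0; rewrite mean_cosn eqxx mulr1 mulr0z mulr0 mul0r subr0.
split=> // x.
have mvx : mean vx = 0 := mean_der0 dv cvx pv.
have pF : periodic flux 1 by move=> y; rewrite /flux pu pW pZ.
have cVF : continuous (fun y => vx y - flux y) by cont.
have : vx = fun y => flux y - mean flux.
  apply: fourier_ext => //; first by cont.
  - by move=> y; rewrite pF.
  - move=> n; rewrite !fourier_cosE.
    have := cc n => cn.
    apply/eqP; rewrite -subr_eq0 -meanB; [|by cont..].
    rewrite (_ : (fun x => _) = fun x => (vx x - flux x) * cosn n x + mean flux * cosn n x).
      rewrite meanD ?meanZ; [|by cont..]; rewrite mean_cosn.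
      have [->|n0] := eqVneq n 0%N.
        rewrite eqxx mulr1 (_ : (fun x => _) = fun x => vx x - flux x).
          by rewrite meanB // mvx sub0r addNr.
        by apply/funext => y; rewrite /cosn mulr0z mulr0 mul0r cos0 mulr1.
      rewrite (_ : (Posz n == 0) = false) ?mulr0 ?addr0; last exact/negbTE.
      have := Hs n; move/eqP; rewrite mulf_eq0 => /orP[|//].
      by rewrite (negPf (freq_neq0 R n0)).
    by apply/funext => y; ring.
  - move=> n n1; rewrite !fourier_sinE.
    have := cs n => sn.
    apply/eqP; rewrite -subr_eq0 -meanB; [|by cont..].
    rewrite (_ : (fun x => _) = fun x => (vx x - flux x) * sinn n x + mean flux * sinn n x).
      rewrite meanD ?meanZ; [|by cont..]; rewrite mean_sinn mulr0 addr0.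
      have n0 : n != 0%N by rewrite -lt0n.
      have := Hc n; rewrite v0 mul0r sub0r => /eqP; rewrite oppr_eq0 mulf_eq0 => /orP[|//].
      by rewrite (negPf (freq_neq0 R n0)).
    by apply/funext => y; ring.
by move=> ->.
Qed.

End Reduced.

(* u(x) - mu = int_0^1 (y - 1/2) u'(x + y) dy, and Cauchy-Schwarz; the kernel
   has squared norm 1/12. *)
Lemma oscillation_bound x : u x - mu <= Num.sqrt 3 / 6 * Num.sqrt E.
Proof.
pose g y := W (x + y).
have cs : continuous (fun y => x + y) by cont.
have cg : continuous g by apply: (cont_comp cW).
have cus : continuous (fun y => u (x + y)) by apply: (cont_comp cu).
have ds y : is_derive y (1 : R) (fun y => x + y) 1.
  exact: (is_derive_eq (derD (der_cst x y) (der_id y)) (add0r _)).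
have dus y : is_derive y (1 : R) (fun y => u (x + y)) (g y).
  by apply: (is_derive_eq (der_comp (du (x + y)) (ds y))); rewrite mulr1.
have shift (f : R -> R) : continuous f -> periodic f 1 -> mean (fun y => f (x + y)) =
  mean f.
  move=> cf pf; have [F [F0 dF]] := primitive_exists cf.
  have dFs y : is_derive y (1 : R) (fun y => F (x + y)) (f (x + y)).
    by apply: (is_derive_eq (der_comp (dF (x + y)) (ds y))); rewrite mulr1.
  rewrite (mean_FTC dFs (cont_comp cf cs)) (mean_FTC dF cf) addr0.
  have d0 y : is_derive y (1 : R) (fun y => F (y + 1) - F y) 0.
    have d1 : is_derive y (1 : R) (fun y : R => y + 1) 1.
      exact: (is_derive_eq (derD (der_id y) (der_cst 1 y)) (addr0 _)).
    have d2 := @der_comp R F (fun y => y + 1) y _ _ (dF (y + 1)) d1.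
    by apply: (is_derive_eq (derD d2 (derN (dF y)))); rewrite pf mulr1 subrr.
  by have := der0_cst d0 x 0; rewrite add0r.
have Ig : mean (fun y => (y - 2^-1) * g y) = u x - mu.
  have dK y : is_derive y (1 : R) (fun y => (y - 2^-1) * u (x + y))
      (u (x + y) + (y - 2^-1) * g y).
    apply: (is_derive_eq (derM (derD (der_id y) (der_cst (- 2^-1) y)) (dus y))).
    by rewrite addr0 mul1r.
  have cK : continuous (fun y => u (x + y) + (y - 2^-1) * g y) by cont.
  have := mean_FTC dK cK; rewrite meanD; [|by cont..].
  rewrite shift // -/mu pu addr0; lra.
have Ik : mean (fun y : R => (y - 2^-1) ^+ 2) = 12^-1.
  have dK y : is_derive y (1 : R) (fun y => 3^-1 * ((y - 2^-1) * (y - 2^-1) ^+ 2))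
      ((y - 2^-1) ^+ 2).
    by eapply is_derive_eq; [der fail | rewrite /=; field].
  by rewrite (mean_FTC dK); [field | cont].
have IE : mean (fun y => g y ^+ 2) = E.
  rewrite (shift (fun y => W y ^+ 2)) //; first by cont.
  by move=> y; rewrite pW.
set I := u x - mu.
(* Subtracts the projection of [g] onto the kernel: their product has mean [I] and the kernel has
   squared norm 1/12, whence the coefficient 12 I. The residual is nonnegative, so I^2 <= E / 12. *)
have : 0 <= mean (fun y => (g y - 12 * I * (y - 2^-1)) ^+ 2).
  by apply: mean_ge0 => [|y _]; [cont | exact: sqr_ge0].
rewrite (_ : (fun y => _) = fun y => g y ^+ 2 - 24 * I * ((y - 2^-1) * g y)
    + 144 * I ^+ 2 * (y - 2^-1) ^+ 2); last by apply/funext => y; ring.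
rewrite meanD; [|by cont..]; rewrite meanB; [|by cont..].
rewrite !meanZ; [|by cont..]; rewrite IE Ig Ik -/I => h.
have I2 : I ^+ 2 <= E / 12 by lra.
apply: le_trans (ler_norm _) _; rewrite -sqrtr_sqr.
have -> : Num.sqrt 3 / 6 * Num.sqrt E = Num.sqrt (E / 12).
  have -> : E / 12 = (6^-1) ^+ 2 * (3 * E) by field.
  by rewrite sqrtrM ?sqr_ge0 // sqrtr_sqr ger0_norm ?invr_ge0 // sqrtrM // mulrCA mulrA.
exact: ler_wsqrtr.
Qed.

End FixedTime.

(** * Regularity in time and conserved quantities *)

Section SupBounds.
Context {R : realType}.
Implicit Types (f fd fdd : R -> R) (s e : R).

(** The derivative is an argument rather than an output, so that the bound applies to differences
    and difference quotients in time whose derivatives are already at hand. *)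
Lemma sobolev_C1_bound s : 3 / 2 < s -> exists2 C : R, 0 < C &
  forall f fd e, 0 < e -> periodic f 1 ->
    (forall x, is_derive x (1 : R) f (fd x)) ->
    (sobolev_norm s f <= e%:E)%E ->
    [/\ continuous fd, periodic fd 1, (sobolev_norm (s - 1) fd <= e%:E)%E &
      forall x, `|f x| <= C * e /\ `|fd x| <= C * e].
Proof.
move=> s32; have s0 : 2^-1 < s by lra.
have s1 : 2^-1 < s - 1 by lra.
have [C0 C00 H0] := sobolev_sup_bound s0.
have [C1 C10 H1] := sobolev_sup_bound s1.
exists (C0 + C1); first lra.
move=> f fd e e0 pf df fe; have cf := der_continuous df.
have sf : sobolev s f by split => //; apply: le_lt_trans fe _; exact: ltry.
have [g [dg [pg cg ng] ne]] := sobolev_derivable s32 sf.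
have Eg : g = fd.
  by apply/funext => x; exact: is_derive_unique (dg x) (df x).
rewrite Eg in pg cg ng ne.
have fde := le_trans ne fe.
split => // x; have := H0 f e e0 cf pf fe x; have := H1 fd e e0 cg pg fde x.
have := mulr_gt0 C00 e0; have := mulr_gt0 C10 e0.
by rewrite mulrDl => *; split; lra.
Qed.

Lemma sobolev_C2_bound s : 5 / 2 < s -> exists2 C : R, 0 < C &
  forall f fd fdd e, 0 < e -> periodic f 1 ->
    (forall x, is_derive x (1 : R) f (fd x)) ->
    (forall x, is_derive x (1 : R) fd (fdd x)) ->
    (sobolev_norm s f <= e%:E)%E ->
    forall x, [/\ `|f x| <= C * e, `|fd x| <= C * e & `|fdd x| <= C * e].
Proof.
move=> s52; have s0 : 3 / 2 < s by lra.
have s1 : 3 / 2 < s - 1 by lra.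
have [C0 C00 H0] := sobolev_C1_bound s0.
have [C1 C10 H1] := sobolev_C1_bound s1.
exists (C0 + C1); first lra.
move=> f fd fdd e e0 pf df dfd fe x.
have [cfd pfd nfd H] := H0 f fd e e0 pf df fe.
have [_ _ _ H'] := H1 fd fdd e e0 pfd dfd nfd.
have [h1 h2] := H x; have [h3 h4] := H' x.
have := mulr_gt0 C00 e0; have := mulr_gt0 C10 e0.
by rewrite mulrDl => *; split; lra.
Qed.

Lemma sobolev_C1_derive s f : 3 / 2 < s -> sobolev s f ->
  [/\ forall x, is_derive x (1 : R) f (derive1 f x), sobolev (s - 1) (derive1 f)
    & periodic f 1].
Proof.
move=> s32 sf; have [g [dg sg _]] := sobolev_derivable s32 sf.
have -> : derive1 f = g by apply/funext => x; exact: is_derive_derive1.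
by split => //; case: sf.
Qed.

Lemma sobolev_C2_derive s f : 5 / 2 < s -> sobolev s f ->
  [/\ forall x, is_derive x (1 : R) f (derive1 f x),
      forall x, is_derive x (1 : R) (derive1 f) (derive1n 2 f x),
      continuous (derive1n 2 f)
    & [/\ periodic f 1, periodic (derive1 f) 1 & periodic (derive1n 2 f) 1]].
Proof.
move=> s52 sf; have s0 : 3 / 2 < s by lra.
have s1 : 3 / 2 < s - 1 by lra.
have [d1 sf1 p0] := sobolev_C1_derive s0 sf.
have [d2 [p2 c2 _] p1] := sobolev_C1_derive s1 sf1.
by split.
Qed.

Lemma ecvg0_within (F : R -> \bar R) (G : set_system R) {FG : Filter G} e :
  F x @[x --> G] --> 0%E -> 0 < e -> G [set t | (F t <= e%:E)%E].
Proof.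
move=> FG0 e0; have : nbhs (0%E : \bar R) [set y : \bar R | (y < e%:E)%E].
  apply: open_nbhs_nbhs; split; first exact: open_ereal_lt_ereal.
  by rewrite /= lte_fin.
by move=> /FG0; apply: (@filterS _ G FG) => t; exact: ltW.
Qed.

End SupBounds.

(** * Continuity and boundedness jointly in time and space *)

Section JointContinuity.
Context {R : realType}.
Implicit Types (Y : R -> R -> R).

(** The uniformity is in x, at each time t separately. *)
Definition uniformly_continuous_in_time Y := forall (t e : R), 0 < e ->
  exists2 d : R, 0 < d & forall t' : R, `|t' - t| < d ->
    forall x, `|Y t' x - Y t x| <= e.

Lemma joint_continuity Y : (forall t, continuous (Y t)) ->
  uniformly_continuous_in_time Y ->
  continuous (fun p : R * R => Y p.1 p.2).
Proof.
move=> cY uY [t x]; apply/cvgrPdist_le => e e0 /=.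
have e2 : 0 < e / 2 by rewrite divr_gt0.
have [d d0 Hd] := uY t _ e2.
have /cvgrPdist_le /(_ _ e2) /nbhs_ballP [c /= c0 Hc] := cY t x.
exists (ball t d, ball x c) => /=.
  by split; exact: nbhsx_ballx.
move=> [t' x'] [/= Bt Bx].
have h1 : `|t' - t| < d by rewrite distrC.
have /= h2 := Hd t' h1 x'; have /= h3 := Hc x' Bx .
rewrite /=; have := ler_distD (Y t x') (Y t x) (Y t' x').
by rewrite (distrC (Y t x') (Y t' x')); lra.
Qed.

Lemma joint_bounded Y (T : R) : 0 <= T ->
  continuous (fun p : R * R => Y p.1 p.2) ->
  (forall t, periodic (Y t) 1) ->
  exists B : R, forall t x, 0 <= t <= T -> `|Y t x| <= B.
Proof.
move=> T0 cY pY.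
pose K := `[0, T] `*` `[(0:R), 1].
have cK : compact K by apply: compact_setX; exact: segment_compact.
have K0 : K !=set0 by exists (0, 0); split; rewrite /= in_itv /= lexx ?T0 ?ler01.
have cn : continuous (fun p : R * R => `|Y p.1 p.2|).
  by apply: cont_comp => // x; exact: norm_continuous.
have [c cKc H] := compact_EVT_max K0 cK (continuous_subspaceT cn).
exists (`|Y c.1 c.2|) => t x tT.
rewrite -(@periodic_int R (Y t) (- Num.floor x) x (pY t)).
have h := floor_itv x; move: h; rewrite intrD => /andP[h1 h2].
have hx : 0 <= x + (- Num.floor x)%:~R <= 1.
  by rewrite mulrNz; apply/andP; split; lra.
by apply: (H (t, _)); rewrite inE; split; rewrite /= in_itv.
Qed.

End JointContinuity.

Lemma periodic_bounded (R : realType) (f : R -> R) : continuous f ->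
  periodic f 1 -> exists B : R, forall x, `|f x| <= B.
Proof.
move=> cf pf; have cY : continuous (fun p : R * R => f p.2).
  by apply: cont_comp => // p; exact: cvg_snd.
have [B HB] := @joint_bounded R (fun _ => f) 0 (lexx _) cY (fun=> pf).
by exists B => x; apply: (HB 0); rewrite lexx.
Qed.

Definition clamp (R : realType) (T t : R) : R := Num.max 0 (Num.min t T).

Lemma clampP (R : realType) (T t : R) : 0 <= T -> 0 <= clamp T t <= T.
Proof. by move=> T0; rewrite /clamp le_max lexx /= ge_max T0 ge_min lexx orbT. Qed.

Lemma clamp_id (R : realType) (T t : R) : 0 <= t <= T -> clamp T t = t.
Proof. by move=> /andP[t0 tT]; rewrite /clamp min_l // max_r. Qed.

Lemma clamp_dist (R : realType) (T t t' : R) :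
  `|clamp T t' - clamp T t| <= `|t' - t|.
Proof.
wlog tt : t t' / t <= t'.
  move=> H; have [|/ltW] := leP t t'; first exact: H.
  by move=> /H; rewrite distrC (distrC t).
rewrite ler_norml /clamp (ger0_norm (_ : 0 <= t' - t)) ?subr_ge0 //.
by case: (leP t T) => ?; case: (leP t' T) => ?; case: (leP 0 t) => ?;
   case: (leP 0 t') => ?; case: (leP 0 T) => ?; apply/andP; split; lra.
Qed.

Section Regularity.
Context {R : realType} (k1 k2 s T : R) (u0 : R -> R) (Tmax : \bar R)
  (u : R -> R -> R).
Hypothesis s52 : 5 / 2 < s.
Hypothesis T0 : 0 < T.
Hypothesis TT : (T%:E < Tmax)%E.
Hypothesis su : strong_solution k1 k2 s u0 Tmax u.

Let mu := mean u0.
Let E := mean (fun x => derive1 u0 x ^+ 2).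

(* Freezing the solution outside [0, T] makes all fields continuous on R^2, so
   that the endpoints need no one-sided limits. *)
Definition clamped_u t := u (clamp T t).
Definition clamped_ux t := derive1 (clamped_u t).
Definition clamped_uxx t := derive1n 2 (clamped_u t).

Let life t : lifespan Tmax (clamp T t).
Proof.
have /andP[h1 h2] := clampP t (ltW T0); split => //.
by apply: le_lt_trans TT; rewrite lee_fin.
Qed.

Let lifeT t : 0 <= t <= T -> lifespan Tmax t.
Proof. by move=> tT; rewrite -(clamp_id tT). Qed.

Let sU t : sobolev s (clamped_u t).
Proof. by have [_ [v [cu _ _ _]]] := su; have [] := cu _ (life t). Qed.

Lemma space_regularity t : [/\ forall x, is_derive x (1 : R) (clamped_u t) (clamped_ux t x),
      forall x, is_derive x (1 : R) (clamped_ux t) (clamped_uxx t x),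
      continuous (clamped_uxx t)
    & [/\ periodic (clamped_u t) 1, periodic (clamped_ux t) 1 & periodic (clamped_uxx
      t) 1]].
Proof. exact: (sobolev_C2_derive s52 (sU t)). Qed.

Let dU t := let: And4 d _ _ _ := space_regularity t in d.
Let dW t := let: And4 _ d _ _ := space_regularity t in d.
Let cZ t := let: And4 _ _ c _ := space_regularity t in c.
Let pU t : periodic (clamped_u t) 1. Proof. by have [_ _ _ []] := space_regularity t. Qed.
Let pW t : periodic (clamped_ux t) 1. Proof. by have [_ _ _ []] := space_regularity t. Qed.
Let pZ t : periodic (clamped_uxx t) 1. Proof. by have [_ _ _ []] := space_regularity t. Qed.
Let cU t : continuous (clamped_u t) := der_continuous (dU t).
Let cW t : continuous (clamped_ux t) := der_continuous (dW t).

(** Continuity in time with values in H^s, combined with the embedding of H^s in C^2, for which s >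
    5/2 is required. *)
Lemma time_continuity : [/\ uniformly_continuous_in_time clamped_u,
  uniformly_continuous_in_time clamped_ux & uniformly_continuous_in_time clamped_uxx].
Proof.
suff H (t e : R) : 0 < e -> exists2 d : R, 0 < d & forall t' : R, `|t' - t| < d ->
    forall x, [/\ `|clamped_u t' x - clamped_u t x| <= e, `|clamped_ux t' x -
      clamped_ux t x| <= e
      & `|clamped_uxx t' x - clamped_uxx t x| <= e].
  by split=> t e e0; have [d d0 Hd] := H t e e0; exists d => // t' tt' x;
    have [] := Hd t' tt' x.
move=> e0; have [C C0 HC] := sobolev_C2_bound s52.
have [_ [v [cu _ _ _]]] := su; have [_ cv] := cu _ (life t).
have eC : 0 < e / C by rewrite divr_gt0.
have /nbhs_ballP [d /= d0 Hd] : nbhs (clamp T t) (fun t' => lifespan Tmax t' ->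
    (sobolev_norm s (fun x => u t' x - u (clamp T t) x)%R <= (e / C)%:E)%E).
  exact: ecvg0_within cv eC.
exists d => // t' tt' x.
have Bt : ball (clamp T t) d (clamp T t').
  rewrite /ball /= distrC; exact: le_lt_trans (clamp_dist _ _ _) tt'.
have /= := Hd _ Bt (life t') => Hn.
have := HC (fun y => clamped_u t' y - clamped_u t y) (fun y => clamped_ux t' y -
  clamped_ux t y)
  (fun y => clamped_uxx t' y - clamped_uxx t y) _ eC _ _ _ Hn x.
rewrite mulrCA divff ?gt_eqF // mulr1; apply.
- by move=> y; rewrite !pU.
- by move=> y; exact: (derD (dU t' y) (derN (dU t y))).
- by move=> y; exact: (derD (dW t' y) (derN (dW t y))).
Qed.

Lemma joint_regularity :
  [/\ continuous (fun p : R * R => clamped_u p.1 p.2), continuous (fun p : R * R =>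
    clamped_ux p.1 p.2)
    & continuous (fun p : R * R => clamped_uxx p.1 p.2)].
Proof.
have [uU uW uZ] := time_continuity.
by split; apply: joint_continuity.
Qed.

Lemma fields_bounded : exists B : R, forall t x,
  [/\ `|clamped_u t x| <= B, `|clamped_ux t x| <= B & `|clamped_uxx t x| <= B].
Proof.
have [jU jW jZ] := joint_regularity.
have [B1 H1] := joint_bounded (ltW T0) jU pU.
have [B2 H2] := joint_bounded (ltW T0) jW pW.
have [B3 H3] := joint_bounded (ltW T0) jZ pZ.
have cc t : clamp T (clamp T t) = clamp T t by rewrite clamp_id // clampP // ltW.
have UE t : clamped_u (clamp T t) = clamped_u t by rewrite /clamped_u cc.
exists (Num.max B1 (Num.max B2 B3)) => t x; have h := clampP t (ltW T0).
rewrite !le_max; split.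
- by have := H1 _ x h; rewrite UE => ->.
- by have := H2 _ x h; rewrite /clamped_ux UE => ->; rewrite orbT.
- by have := H3 _ x h; rewrite /clamped_uxx UE => ->; rewrite !orbT.
Qed.

(** The difference quotient minus u_t is small in H^(s-1), and s - 1 > 3/2 turns this into smallness
    in C^1. Nothing comparable is available for u_xx, whose time derivative is out of reach here. *)
Lemma time_derivative t : 0 < t < T -> exists v vx : R -> R,
  [/\ forall x, is_derive x (1 : R) v (vx x), continuous vx,
      periodic v 1 /\ periodic vx 1, equation_at k1 k2 (clamped_u t) v
    & forall e : R, 0 < e -> exists2 d : R, 0 < d & forall t' : R, `|t' - t| < d ->
        forall x, `|clamped_u t' x - clamped_u t x - (t' - t) * v x| <= e * `|t' - t| /\
                  `|clamped_ux t' x - clamped_ux t x - (t' - t) * vx x| <= e * `|t' - t|].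
Proof.
have s1 : 3 / 2 < s - 1 by move: s52; lra.
move=> /andP[t0 tT]; have [_ [v [_ cv dv eqv]]] := su.
have tT' : 0 <= t <= T by rewrite !ltW.
have lt := lifeT tT'; have ct := clamp_id tT'.
have [svt _] := cv _ lt.
have [dvt [_ cvx _] pv] := sobolev_C1_derive s1 svt.
have pvx : periodic (derive1 (v t)) 1.
  by have [_ [pvx _ _] _] := sobolev_C1_derive s1 svt.
exists (v t), (derive1 (v t)); split => //.
  by rewrite /clamped_u ct; exact: eqv.
move=> e e0; have [C C0 HC] := sobolev_C1_bound s1.
have eC : 0 < e / C by rewrite divr_gt0.
have /nbhs_ballP [d /= d0 Hd] : nbhs t (fun t' => t' != t -> lifespan Tmax t' ->
    (sobolev_norm (s - 1) (fun x => (t' - t)^-1 * (u t' x - u t x) - v t x)%R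
      <= (e / C)%:E)%E).
  exact: ecvg0_within (dv _ lt) eC.
(* The last two bounds keep t' in [0, T], where freezing has no effect. *)
exists (Num.min d (Num.min t (T - t))).
  by rewrite !lt_min d0 t0 subr_gt0.
move=> t'; rewrite !lt_min => /and3P[td tt Tt] x.
have [->|tt'] := eqVneq t' t; first by rewrite !subrr !mul0r !subrr normr0 mulr0.
have tT'' : 0 <= t' <= T.
  by move: tt Tt; rewrite !ltr_norml => /andP[h1 h2] /andP[h3 h4]; apply/andP; split; lra.
have ct' := clamp_id tT''.
have Bt : ball t d t' by rewrite /ball /= distrC.
have /= Hn := Hd _ Bt tt' (lifeT tT'').
pose q := (t' - t)^-1.
have q0 : t' - t != 0 by rewrite subr_eq0.
have UE' : clamped_u t' = u t' by rewrite /clamped_u ct'.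
have UE : clamped_u t = u t by rewrite /clamped_u ct.
have p1 : periodic (fun y => q * (clamped_u t' y - clamped_u t y) - v t y) 1.
  by move=> y; rewrite !pU pv.
have d1 y : is_derive y (1 : R) (fun y => q * (clamped_u t' y - clamped_u t y) - v t y)
    (q * (clamped_ux t' y - clamped_ux t y) - derive1 (v t) y).
  apply: (is_derive_eq (derD (derM (der_cst q y) (derD (dU t' y) (derN (dU t y))))
      (derN (dvt y)))).
  by rewrite mul0r add0r.
rewrite -UE -UE' -/q in Hn.
have [_ _ _ /(_ x)] := HC _ _ _ eC p1 d1 Hn.
rewrite mulrCA divff ?gt_eqF // mulr1 => -[h1 h2].
have key (a b : R) : `|q * a - b| <= e -> `|a - (t' - t) * b| <= e * `|t' - t|.
  move=> h; have -> : a - (t' - t) * b = (q * a - b) * (t' - t) by rewrite /q; field.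
  by rewrite normrM ler_wpM2r.
by split; apply: key.
Qed.

Let const_on (phi : R -> R) : continuous phi ->
  (forall t, 0 < t < T -> is_derive t (1 : R) phi 0) ->
  forall t, 0 <= t <= T -> phi t = phi 0.
Proof.
move=> cphi dphi t /andP[t0 tT].
have [|c _] := @MVT_le R 0 t phi (fun=> 0) t0 _ (continuous_subspaceT cphi).
  by move=> x /andP[x0 xt]; apply: dphi; rewrite x0 (lt_le_trans xt tT).
by rewrite mul0r => /eqP; rewrite subr_eq0 => /eqP.
Qed.

Let cont_mean (Y : R -> R -> R) : (forall t, continuous (Y t)) ->
  uniformly_continuous_in_time Y ->
  continuous (fun t => mean (Y t)).
Proof.
move=> cY uY t; apply/cvgrPdist_le => e e0; have [d d0 Hd] := uY t e e0.
apply/nbhs_ballP; exists d => //= t' Bt; rewrite -(meanB (cY t) (cY t')).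
apply: mean_abs_le => [|x]; first by have := cY t; have := cY t' => ? ?; cont.
by rewrite distrC; apply: Hd; rewrite distrC.
Qed.

Let U0 : clamped_u 0 = u0.
Proof. by rewrite /clamped_u clamp_id ?lexx ?ltW //; have [-> _] := su. Qed.

(** The derivative is the mean of u_t, which is 0. Averaging a remainder uniform in x replaces
    differentiation under the integral sign. *)
Lemma mean_conserved t : 0 <= t <= T -> mean (clamped_u t) = mu.
Proof.
move=> tT; rewrite /mu -U0; have [uU _ _] := time_continuity.
apply: (@const_on (fun t => mean (clamped_u t)) _ _ t tT) => [|{tT}t tT].
  exact: cont_mean.
have [v [vx [dv cvx [pv pvx] eqv Hv]]] := time_derivative tT.
have [v0 _] := velocity_gradient (@dU t) (@dW t) (@cZ t) (@pU t) (@pW t) (@pZ t)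
  dv cvx pv pvx eqv.
apply/is_deriveP => e e0; have [d d0 Hd] := Hv e e0; exists d => // t' tt'.
have cv := der_continuous dv; have cu := (@cU t); have cu' := (@cU t').
rewrite mul0r subr0.
have -> : mean (clamped_u t') - mean (clamped_u t) = mean (fun x => clamped_u t' x -
  clamped_u t x - (t' - t) * v x).
  rewrite (meanB (f := fun x => clamped_u t' x - clamped_u t x)); [|by cont..].
  by rewrite meanB // meanZ // v0 mulr0 subr0.
apply: mean_abs_le => [|x]; first by cont.
by have [] := Hd t' tt' x.
Qed.

Lemma velocity_gradient_flux t v vx : 0 < t < T ->
  (forall x, is_derive x (1 : R) v (vx x)) -> continuous vx -> periodic v 1 ->
  periodic vx 1 -> equation_at k1 k2 (clamped_u t) v ->
  forall x, vx x = flux k1 k2 (clamped_u t) (clamped_ux t) (clamped_uxx t) x - mean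
    (flux k1 k2 (clamped_u t) (clamped_ux t) (clamped_uxx t)).
Proof.
move=> tT dv cvx pv pvx eqv.
by have [] := velocity_gradient (@dU t) (@dW t) (@cZ t) (@pU t) (@pW t) (@pZ t)
  dv cvx pv pvx eqv.
Qed.

(** The derivative is twice the mean of u_x u_tx, and u_tx is the flux minus a constant: u_x times
    the flux has mean 0, and so has u_x. *)
Lemma energy_conserved t : 0 <= t <= T -> mean (fun x => clamped_ux t x ^+ 2) = E.
Proof.
move=> tT; rewrite /E -U0 -/(clamped_ux 0); have [_ uW _] := time_continuity.
have [B HB] := fields_bounded.
have WB r x : `|clamped_ux r x| <= B by have [_ ->] := HB r x.
have B0 : 0 <= B by apply: le_trans (WB 0 0).
have cW2 r : continuous (fun x => clamped_ux r x ^+ 2) by have := @cW r => ?; cont.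
apply: (@const_on (fun t => mean (fun x => clamped_ux t x ^+ 2)) _ _ t tT) => [|{tT}t tT].
  apply: cont_mean => // {tT}t e e0.
  have eB : 0 < e / (2 * B + 1) by rewrite divr_gt0 //; lra.
  have [d d0 Hd] := uW t _ eB; exists d => // t' tt' x.
  rewrite subr_sqr normrM.
  have h1 := Hd t' tt' x; have h2 : `|clamped_ux t' x + clamped_ux t x| <= 2 * B + 1.
    by apply: le_trans (ler_normD _ _) _; have := WB t x; have := WB t' x; lra.
  have := ler_pM (normr_ge0 _) (normr_ge0 _) h1 h2.
  by rewrite divfK // gt_eqF //; lra.
have [v [vx [dv cvx [pv pvx] eqv Hv]]] := time_derivative tT.
have vxE := velocity_gradient_flux tT dv cvx pv pvx eqv.
have Wvx : mean (fun x => clamped_ux t x * vx x) = 0.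
  set F := flux _ _ _ _ _ in vxE.
  have cF : continuous F by exact: cont_flux.
  rewrite (_ : (fun x => _) = fun x => clamped_ux t x * F x - mean F * clamped_ux t x);
    last first.
    by apply/funext => x; rewrite vxE; ring.
  have cw := (@cW t); rewrite meanB; [|by cont..].
  rewrite meanZ // (mean_W (@dU t) (@dW t) (@pU t)) mulr0 subr0.
  exact: (mean_flux_W k1 k2 (@dU t) (@dW t) (@cZ t) (@pU t) (@pW t)).
have [Bv HBv] := periodic_bounded cvx pvx.
have Bv0 : 0 <= Bv by apply: le_trans (HBv 0).
apply/is_deriveP => e e0.
(* Half of [e] for each error term of the expansion of the difference of squares: the remainder [r]
   is multiplied by at most 2 B + 1, the increment of u_x by at most Bv + 1. *)
pose e1 := e / (2 * B + 1) / 2; pose e2 := e / (Bv + 1) / 2.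
have e10 : 0 < e1 by rewrite !divr_gt0 //; lra.
have e20 : 0 < e2 by rewrite !divr_gt0 //; lra.
have [d1 d10 Hd1] := Hv _ e10; have [d2 d20 Hd2] := uW t _ e20.
exists (Num.min d1 d2); first by rewrite lt_min d10.
move=> t'; rewrite lt_min => /andP[tt1 tt2].
have cw := (@cW t); have cw' := (@cW t').
have cw2 := (@cW2 t); have cw2' := (@cW2 t').
rewrite mul0r subr0.
have -> : mean (fun x => clamped_ux t' x ^+ 2) - mean (fun x => clamped_ux t x ^+ 2) =
    mean (fun x => clamped_ux t' x ^+ 2 - clamped_ux t x ^+ 2 - (2 * (t' - t)) *
      (clamped_ux t x * vx x)).
  rewrite (meanB (f := fun x => clamped_ux t' x ^+ 2 - clamped_ux t x ^+ 2)); [|by cont..].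
  rewrite (meanB cw2' cw2) meanZ; last by cont.
  by rewrite Wvx mulr0 subr0.
apply: mean_abs_le => [|x]; first by cont.
have [_ h1] := Hd1 t' tt1 x; have h2 := Hd2 t' tt2 x.
set r := clamped_ux t' x - clamped_ux t x - (t' - t) * vx x in h1.
have -> : clamped_ux t' x ^+ 2 - clamped_ux t x ^+ 2 - 2 * (t' - t) * (clamped_ux t x *
  vx x) =
    (t' - t) * (vx x * (clamped_ux t' x - clamped_ux t x)) + r * (clamped_ux t' x +
      clamped_ux t x) by rewrite /r; ring.
have h3 : `|clamped_ux t' x + clamped_ux t x| <= 2 * B + 1.
  by apply: le_trans (ler_normD _ _) _; have := WB t x; have := WB t' x; lra.
have h4 : `|vx x| <= Bv + 1 by have := HBv x; lra.
apply: le_trans (ler_normD _ _) _; rewrite !normrM.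
have h5 := ler_pM (normr_ge0 _) (normr_ge0 _) h4 h2.
have h6 := ler_pM (normr_ge0 _) (normr_ge0 _) h1 h3.
have E1 : (Bv + 1) * e2 = e / 2 by rewrite /e2; field; rewrite gt_eqF //; lra.
have E2 : e1 * `|t' - t| * (2 * B + 1) = e / 2 * `|t' - t|.
  by rewrite /e1; field; rewrite gt_eqF //; lra.
rewrite E1 in h5; rewrite E2 in h6.
have := ler_wpM2l (normr_ge0 (t' - t)) h5; lra.
Qed.

Lemma oscillation t x : 0 <= t <= T -> clamped_u t x - mu <= Num.sqrt 3 / 6 * Num.sqrt E.
Proof.
move=> tT; rewrite -(mean_conserved tT) -(energy_conserved tT).
exact: oscillation_bound (@dU t) (@dW t) (@pU t) (@pW t) x.
Qed.

Lemma gradient_time_derivative t : 0 < t < T ->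
  forall e : R, 0 < e -> exists2 d : R, 0 < d & forall t' : R, `|t' - t| < d ->
    forall x, `|clamped_ux t' x - clamped_ux t x - (t' - t) *
       (k1 * ((2 * mu * clamped_u t x - clamped_ux t x ^+ 2) * (mu - clamped_uxx t x))
        + k2 * (clamped_u t x * (mu - clamped_uxx t x) + mu * clamped_u t x - 2^-1 *
          clamped_ux t x ^+ 2)
        - (k1 * (2 * mu ^+ 3 + mu * E) + k2 * (2 * mu ^+ 2 + 2^-1 * E)))|
    <= e * `|t' - t|.
Proof.
move=> tT e e0; have tT' : 0 <= t <= T by case/andP: tT => *; rewrite !ltW.
have [v [vx [dv cvx [pv pvx] eqv Hv]]] := time_derivative tT.
have vxE := velocity_gradient_flux tT dv cvx pv pvx eqv.
have [d d0 Hd] := Hv e e0; exists d => // t' tt' x; have [_] := Hd t' tt' x.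
rewrite vxE (mean_flux k1 k2 (@dU t) (@dW t) (@cZ t) (@pU t) (@pW t)).
by rewrite /flux (mean_conserved tT') (energy_conserved tT').
Qed.

End Regularity.

(** * Characteristics *)

Section Comparison.
Context {R : realType}.
Implicit Types (f g df dg : R -> R) (T t : R).

Lemma der_nondecreasing f df T : continuous f ->
  (forall t, 0 < t < T -> is_derive t (1 : R) f (df t)) ->
  (forall t, 0 < t < T -> 0 <= df t) ->
  forall t, 0 <= t <= T -> f 0 <= f t.
Proof.
move=> cf Df df0 t /andP[]; rewrite le_eqVlt => /predU1P[<- _//|t0 tT].
have Hd z : z \in `]0, t[%R -> is_derive z (1 : R) f (df z).
  by rewrite in_itv /= => /andP[z0 zt]; apply: Df; rewrite z0 (lt_le_trans zt tT).
have [c] := MVT t0 Hd (continuous_subspaceT cf).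
rewrite in_itv /= => /andP[c0 ct] E.
rewrite -subr_ge0 E; apply: mulr_ge0; last by rewrite subr_ge0 ltW.
by apply: df0; rewrite c0 (lt_le_trans ct tT).
Qed.

(** Stands for the inequality between an integral and the integral of a majorant; it follows from
    the monotonicity of g - f and g + f. *)
Lemma der_dominated f g df dg T : continuous f -> continuous g ->
  (forall t, 0 < t < T -> is_derive t (1 : R) f (df t)) ->
  (forall t, 0 < t < T -> is_derive t (1 : R) g (dg t)) ->
  (forall t, 0 < t < T -> `|df t| <= dg t) -> `|f 0| <= g 0 ->
  forall t, 0 <= t <= T -> `|f t| <= g t.
Proof.
move=> cf cg Df Dg H H0 t tT.
have h1 : (g 0 - f 0) <= (g t - f t).
  apply: (@der_nondecreasing (fun t => g t - f t) (fun t => dg t - df t) T) => //.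
  - by cont.
  - by move=> x xT; exact: (derD (Dg x xT) (derN (Df x xT))).
  - by move=> x xT; have := H x xT; rewrite ler_norml subr_ge0 => /andP[].
have h2 : (g 0 + f 0) <= (g t + f t).
  apply: (@der_nondecreasing (fun t => g t + f t) (fun t => dg t + df t) T) => //.
  - by cont.
  - by move=> x xT; exact: (derD (Dg x xT) (Df x xT)).
  - by move=> x xT; have := H x xT; rewrite ler_norml => /andP[h _]; lra.
by move: H0; rewrite !ler_norml => /andP[h3 h4]; apply/andP; split; lra.
Qed.

Lemma MVT_between f df (a b : R) :
  (forall x, Num.min a b <= x <= Num.max a b -> is_derive x (1 : R) f (df x)) ->
  exists2 c, Num.min a b <= c <= Num.max a b & f b - f a = df c * (b - a).
Proof.
wlog ab : a b / a <= b.
  move=> H; have /orP[ab|ba] := le_total a b; first exact: H.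
  rewrite minC maxC => D; have [c cab E] := H _ _ ba D.
  by exists c => //; rewrite -(opprB (f a)) E -mulrN opprB.
rewrite (min_l ab) (max_r ab) => D.
apply: MVT_le => //.
  by move=> x /andP[ax xb]; apply: D; rewrite !ltW.
apply: derivable_within_continuous => x; rewrite in_itv /= => xab.
by apply: ex_derive; apply: D.
Qed.

End Comparison.

(** * Picard iteration on a given time interval *)

Section Picard.
Context {R : realType}.

Lemma joint_comp (a : R -> R -> R) (q : R -> R) :
  continuous (fun p : R * R => a p.1 p.2) -> continuous q ->
  continuous (fun t => a t (q t)).
Proof.
move=> ca cq t; apply/cvgrPdist_le => e e0.
have /cvgrPdist_le /(_ e e0) [[A B] /= [nA nB] HAB] := ca (t, q t).
have nB' : nbhs t (q @^-1` B) := cq t _ nB.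
apply: filterS2 nA nB' => t' At Bt; exact: (HAB (t', q t') (conj At Bt)).
Qed.

Lemma primitive_operator : exists P : (R -> R) -> (R -> R), forall f, continuous f ->
  P f 0 = 0 /\ forall x, is_derive x (1 : R) (P f) (f x).
Proof.
have H (f : R -> R) : exists F : R -> R, continuous f ->
    F 0 = 0 /\ forall x, is_derive x (1 : R) F (f x).
  (* A default value: the operator is only applied to continuous functions. *)
  have [cf|ncf] := pselect (continuous f); last by exists f.
  by have [F HF] := primitive_exists cf; exists F.
by have [P HP] := choice H; exists P.
Qed.

(** Measured with the weight exp (2 L t), each iteration halves the distance, so the whole of [0, T]
    is reached without subdivision. *)
Lemma picard (a : R -> R -> R) (L M T x0 : R) :
  continuous (fun p : R * R => a p.1 p.2) -> 0 < L -> 0 < T ->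
  (forall t x, `|a t x| <= M) ->
  (forall t x y, `|a t x - a t y| <= L * `|x - y|) ->
  exists q : R -> R, [/\ continuous q, q 0 = x0 &
    forall t, 0 <= t <= T -> is_derive t (1 : R) q (a t (q t))].
Proof.
move=> ca L0 T0 aM aL; have M0 : 0 <= M by apply: le_trans (aM 0 0).
have [P HP] := primitive_operator.
have cac q : continuous q -> continuous (fun t => a t (q t)).
  by move=> cq; exact: joint_comp.
pose step (q : R -> R) (t : R) : R := x0 + P (fun t => a t (q t)) t.
pose q n := iter n step (fun=> x0).
have dstep p : continuous p -> forall t, is_derive t (1 : R) (step p) (a t (p t)).
  move=> cp t; have [_ H] := HP _ (cac p cp).
  exact: (is_derive_eq (derD (der_cst x0 t) (H t)) (add0r _)).
have step0 p : continuous p -> step p 0 = x0.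
  by move=> cp; rewrite /step; have [-> _] := HP _ (cac p cp); rewrite addr0.
have cq n : continuous (q n).
  elim: n => [|n IH]; first exact: cont_cst.
  exact: der_continuous (dstep _ IH).
have q0 n : q n 0 = x0 by case: n => [//|n]; exact: step0 (cq n).
pose C := M * T * expR (2 * L * T).
have C0 : 0 <= C by rewrite !mulr_ge0 ?expR_ge0 // ltW.
(* Chosen so that the derivative of [w n.+1] is exactly [L * w n], the Lipschitz bound on the
   derivative of the next increment. *)
pose w n t := M * T * 2^-1 ^+ n * expR (2 * L * t).
have dw n t : is_derive t (1 : R) (w n.+1) (L * w n t).
  by rewrite /w; eapply is_derive_eq; [der fail | rewrite /= exprS; field].
have cw n : continuous (w n).
  apply: (@der_continuous R _ (fun t => 2 * L * w n t)) => t.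
  by rewrite /w; eapply is_derive_eq; [der fail | rewrite /=; ring].
have D n t : 0 <= t <= T -> `|q n.+1 t - q n t| <= w n t.
  elim: n t => [|n IH] t tT.
    have dlin z : is_derive z (1 : R) (fun z => M * z) M.
      apply: (is_derive_eq (derM (der_cst M z) (der_id z))).
      by rewrite mul0r add0r mulr1.
    have h : `|q 1%N t - x0| <= M * t.
      have cl : continuous (fun z : R => M * z) by cont.
      have cq1 : continuous (fun z => q 1%N z - x0) by have := cq 1%N => ?; cont.
      apply: (@der_dominated R (fun z => q 1%N z - x0) (fun z => M * z)
        (fun z => a z x0) (fun=> M) T) => //.
      - move=> z _.
        exact: (is_derive_eq (derD (dstep _ (cq 0%N) z) (der_cst (- x0) z)) (addr0 _)).
      - by rewrite (q0 1%N) subrr normr0 mulr0.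
    apply: le_trans h _; rewrite /w expr0 mulr1 -mulrA ler_wpM2l //.
    case/andP: tT => t0 tT; rewrite -[leLHS]mulr1 ler_pM //.
    by rewrite -expR0 ler_expR !mulr_ge0 // ltW.
  have cd : continuous (fun z => q n.+2 z - q n.+1 z).
    by have := cq n.+2; have := cq n.+1 => ? ?; cont.
  apply: (@der_dominated R (fun z => q n.+2 z - q n.+1 z) (w n.+1)
    (fun z => a z (q n.+1 z) - a z (q n z)) (fun z => L * w n z) T) => //.
  - by move=> z _; exact: (derD (dstep _ (cq n.+1) z) (derN (dstep _ (cq n) z))).
  - move=> z /andP[z0 zT]; apply: le_trans (aL _ _ _) _.
    by rewrite ler_wpM2l ?(ltW L0) // IH // !ltW.
  - rewrite !q0 subrr normr0 /w !mulr_ge0 ?expR_ge0 ?exprn_ge0 ?invr_ge0 //.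
    exact: ltW.
have wC n t : 0 <= t <= T -> w n t <= C * 2^-1 ^+ n.
  case/andP=> t0 tT; rewrite /w /C mulrAC ler_wpM2r ?exprn_ge0 ?invr_ge0 //.
  rewrite ler_wpM2l ?mulr_ge0 ?(ltW T0) // ler_expR ler_wpM2l //.
  by rewrite mulr_ge0 // ltW.
have DC n t : 0 <= t <= T -> `|q n.+1 t - q n t| <= C * 2^-1 ^+ n.
  by move=> tT; exact: le_trans (D n t tT) (wC n t tT).
(* Subtracting the geometric tail makes the iterates nondecreasing in n, so their limit is a
   supremum. *)
pose lo n t := q n t - 2 * C * 2^-1 ^+ n.
have half (n : nat) : 2^-1 ^+ n.+1 = 2^-1 * 2^-1 ^+ n :> R by rewrite exprS.
have DD n j t : 0 <= t <= T ->
    `|q (n + j)%N t - q n t| <= 2 * C * 2^-1 ^+ n - 2 * C * 2^-1 ^+ (n + j).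
  move=> tT; elim: j => [|j IH]; first by rewrite addn0 !subrr normr0.
  rewrite addnS half; have := DC (n + j)%N t tT.
  have := ler_distD (q (n + j)%N t) (q (n + j).+1 t) (q n t); lra.
have hp (n : nat) : 0 <= 2^-1 ^+ n :> R by rewrite exprn_ge0 // invr_ge0.
have lim_ex t : exists l : R, 0 <= t <= T -> forall n, `|l - q n t| <= 2 * C * 2^-1 ^+ n.
  have [tT|_] := boolP (0 <= t <= T); last by exists 0.
  have ub : has_ubound (range (fun n => lo n t)).
    exists (x0 + 2 * C) => _ [n _ <-]; have := DD 0%N n t tT.
    rewrite add0n expr0 mulr1 ler_norml => /andP[_ h].
    have q00 : q 0%N t = x0 by []. 
    have := mulr_ge0 C0 (hp n); rewrite /lo; lra.
  have nd : nondecreasing_seq (fun n => lo n t).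
    apply/nondecreasing_seqP => n; rewrite /lo half; have := DC n t tT.
    rewrite ler_norml => /andP[h _]; lra.
  pose l := sup (range (fun n => lo n t)).
  exists l => _ n; rewrite ler_norml; apply/andP; split.
    have : lo n t <= l by apply: ub_le_sup => //; exists n.
    rewrite /lo; lra.
  suff : l <= q n t + 2 * C * 2^-1 ^+ n by lra.
  apply: ge_sup; first by exists (lo 0%N t), 0%N.
  move=> _ [m _ <-]; have : lo m t <= lo (maxn n m) t by apply: nd; exact: leq_maxr.
  have /subnKC E := leq_maxl n m.
  have := DD n (maxn n m - n)%N t tT; rewrite E ler_norml => /andP[_ h].
  have := mulr_ge0 C0 (hp (maxn n m)); rewrite {2}/lo; lra.
have [p Hp] := choice lim_ex.
(* The limit is controlled on [0, T] only; freezing it outside gives a function continuous on the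
   whole line. *)
pose pc t := p (clamp T t).
have clT t : 0 <= clamp T t <= T by apply: clampP; exact: ltW.
have Hpc n t : `|pc t - q n (clamp T t)| <= 2 * C * 2^-1 ^+ n by exact: Hp.
have tail e : 0 < e -> exists n, 2 * C * 2^-1 ^+ n <= e.
  move=> e0; have := bernoulli_pow (Num.truncn (2 * C / e)).+1 (ler1n R 2 : 1 <= 2).
  set n := _.+1 => h; exists n.
  have h1 : 2 * C / e < n%:R by exact: truncnS_gt.
  have p0 : 0 < 2 ^+ n :> R by rewrite exprn_gt0.
  rewrite exprVn ler_pdivrMr //; move: h1; rewrite ltr_pdivrMr // => h1.
  have := ler_wpM2l (ltW e0) h; lra.
have cpc : continuous pc.
  move=> t; apply/cvgrPdist_le => e e0.
  have e3 : 0 < e / 3 by rewrite divr_gt0.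
  have [n Hn] := tail _ e3.
  have /cvgrPdist_le /(_ _ e3) /nbhs_ballP [d /= d0 Hd] := cq n (clamp T t).
  apply/nbhs_ballP; exists d => //= t' Bt.
  have Bt' : ball (clamp T t) d (clamp T t').
    rewrite /ball /= distrC; apply: le_lt_trans (clamp_dist _ _ _) _.
    by rewrite distrC.
  have /= h1 := Hd _ Bt'; have h2 := Hpc n t; have h3 := Hpc n t'.
  have := ler_distD (q n (clamp T t)) (pc t) (pc t').
  have := ler_distD (q n (clamp T t')) (q n (clamp T t)) (pc t').
  rewrite (distrC (q n (clamp T t')) (pc t')); lra.
have pE t : 0 <= t <= T -> pc t = step pc t.
  move=> tT; apply/eqP; rewrite -subr_eq0 -normr_le0; apply/ler_addgt0Pl => e e0.
  rewrite addr0.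
  pose e' := e / (2 + L * T).
  have LT : 0 < 2 + L * T by rewrite addr_gt0 // mulr_gt0.
  have e'0 : 0 < e' by rewrite divr_gt0.
  have [n Hn] := tail _ e'0.
  have h1 : `|q n.+1 t - step pc t| <= L * e' * t.
    have cl : continuous (fun z : R => L * e' * z) by cont.
    have cd : continuous (fun z => q n.+1 z - step pc z).
      by have := cq n.+1; have := der_continuous (dstep _ cpc) => ? ?; cont.
    have dl (z : R) : is_derive z (1 : R) (fun z => L * e' * z) (L * e').
      apply: (is_derive_eq (derM (der_cst (L * e') z) (der_id z))).
      by rewrite mul0r add0r mulr1.
    apply: (@der_dominated R (fun z => q n.+1 z - step pc z) (fun z => L * e' * z)
        (fun z => a z (q n z) - a z (pc z)) (fun=> L * e') T) => //.
    - by move=> z _; exact: (derD (dstep _ (cq n) z) (derN (dstep _ cpc z))).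
    - move=> z zT; apply: le_trans (aL _ _ _) _; rewrite ler_wpM2l ?(ltW L0) //.
      have zT' : 0 <= z <= T by case/andP: zT => *; rewrite !ltW.
      by rewrite distrC; have := Hpc n z; rewrite clamp_id // => /le_trans; apply.
    - by rewrite q0 step0 // subrr normr0 mulr0.
  have h2 := Hpc n.+1 t; rewrite clamp_id // half in h2.
  have h3 : L * e' * t <= L * e' * T.
    by apply: ler_wpM2l; [rewrite mulr_ge0 // ltW | case/andP: tT].
  have h4 := ler_distD (q n.+1 t) (pc t) (step pc t).
  have h5 := mulr_ge0 C0 (hp n).
  have E : e = e' * (2 + L * T) by rewrite /e' divfK // gt_eqF.
  rewrite E; lra.
(* Equal to [pc] on [0, T], but differentiable everywhere, so the equation holds with two-sided
   derivatives at 0 and T too. *)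
exists (step pc); split.
- exact: der_continuous (dstep _ cpc).
- exact: step0.
- by move=> t tT; rewrite -pE //; exact: dstep.
Qed.

End Picard.

Section Bounded.
Context {R : realType}.
Implicit Types f g : R -> R -> R.

Definition bounded2 f := exists B : R, forall t x, `|f t x| <= B.

Lemma bounded2_cst (c : R) : bounded2 (fun _ _ => c).
Proof. by exists `|c|. Qed.

Lemma bounded2D f g : bounded2 f -> bounded2 g ->
  bounded2 (fun t x => f t x + g t x).
Proof.
move=> [B HB] [C HC]; exists (B + C) => t x.
by apply: le_trans (ler_normD _ _) _; rewrite lerD.
Qed.

Lemma bounded2N f : bounded2 f -> bounded2 (fun t x => - f t x).
Proof. by move=> [B HB]; exists B => t x; rewrite normrN. Qed.

Lemma bounded2M f g : bounded2 f -> bounded2 g ->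
  bounded2 (fun t x => f t x * g t x).
Proof. by move=> [B HB] [C HC]; exists (B * C) => t x; rewrite normrM ler_pM. Qed.

End Bounded.

(** * Transport of u_x and u_xx along characteristics *)

Section Characteristics.
Context {R : realType} (k1 k2 mu E T : R) (U W Z : R -> R -> R).
Hypothesis T0 : 0 < T.
Hypothesis dU : forall t x, is_derive x (1 : R) (U t) (W t x).
Hypothesis dW : forall t x, is_derive x (1 : R) (W t) (Z t x).
Hypothesis jU : continuous (fun p : R * R => U p.1 p.2).
Hypothesis jW : continuous (fun p : R * R => W p.1 p.2).
Hypothesis jZ : continuous (fun p : R * R => Z p.1 p.2).
Hypothesis bU : bounded2 U.
Hypothesis bW : bounded2 W.
Hypothesis bZ : bounded2 Z.

(** [speed] and [source] are the coefficients a and G of the transport equation for u_x: the terms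
    of the flux containing u_xx are collected in - a u_xx, and the mean of the flux is subtracted
    from the rest. *)
Definition speed t x := k1 * (2 * mu * U t x - W t x * W t x) + k2 * U t x.
Definition speed_x t x := W t x * (2 * k1 * (mu - Z t x) + k2).
Definition source t x := (2 * k1 * mu ^+ 2 + 2 * k2 * mu) * (U t x - mu)
  - (k1 * mu + 2^-1 * k2) * (W t x * W t x) - (k1 * mu * E + 2^-1 * k2 * E).
Definition source_x t x := (2 * k1 * mu ^+ 2 + 2 * k2 * mu) * W t x
  - (2 * k1 * mu + k2) * (W t x * Z t x).

Hypothesis Wt : forall t, 0 < t < T ->
  forall e : R, 0 < e -> exists2 d : R, 0 < d & forall t' : R, `|t' - t| < d ->
    forall x, `|W t' x - W t x - (t' - t) * (source t x - speed t x * Z t x)|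
      <= e * `|t' - t|.

Ltac der0 := der ltac:(first [exact: dU | exact: dW]).

Lemma der_speed t x : is_derive x (1 : R) (speed t) (speed_x t x).
Proof.
by rewrite /speed; eapply is_derive_eq; [der0 | rewrite /speed_x /=; ring].
Qed.

Lemma der_source t x : is_derive x (1 : R) (source t) (source_x t x).
Proof.
by rewrite /source; eapply is_derive_eq; [der0 | rewrite /source_x /=; field].
Qed.

Lemma joint_speed : continuous (fun p : R * R => speed p.1 p.2).
Proof. by rewrite /speed; cont. Qed.

Lemma joint_speed_x : continuous (fun p : R * R => speed_x p.1 p.2).
Proof. by rewrite /speed_x; cont. Qed.

Lemma joint_source_x : continuous (fun p : R * R => source_x p.1 p.2).
Proof. by rewrite /source_x; cont. Qed.

Ltac bnd := repeat first [ assumption | apply: bounded2_cst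
  | apply: bounded2D | apply: bounded2N | apply: bounded2M ].

Lemma bounded_speed : bounded2 speed.
Proof. by rewrite /speed; bnd. Qed.

Lemma bounded_speed_x : bounded2 speed_x.
Proof. by rewrite /speed_x; bnd. Qed.

Definition characteristic x0 (q : R -> R) := [/\ continuous q, q 0 = x0 &
  forall t, 0 <= t <= T -> is_derive t (1 : R) q (speed t (q t))].

Lemma speed_lipschitz : exists2 L : R, 0 < L &
  forall t x y, `|speed t x - speed t y| <= L * `|x - y|.
Proof.
have [L HL] := bounded_speed_x; exists (L + 1).
  by have := le_trans (normr_ge0 _) (HL 0 0); lra.
move=> t x y; have [c _ ->] := MVT_all y x (der_speed t).
by rewrite normrM ler_wpM2r //; have := HL t c; lra.
Qed.

Lemma characteristic_exists x0 : exists q, characteristic x0 q.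
Proof.
have [L L0 HL] := speed_lipschitz; have [M HM] := bounded_speed.
exact: (picard x0 joint_speed L0 T0 HM HL).
Qed.

(** The square of the gap, multiplied by exp (-2 L t), is nonincreasing, which gives the bound;
    multiplied by exp (2 L t), it is nondecreasing, so distinct characteristics never meet. *)
Lemma characteristic_gap : exists2 K : R, 0 < K &
  forall x y p q, characteristic x p -> characteristic y q ->
  forall t, 0 <= t <= T -> `|p t - q t| <= K * `|x - y| /\
    (x != y -> p t != q t).
Proof.
have [L L0 HL] := speed_lipschitz; exists (expR (L * T)); first exact: expR_gt0.
move=> x y p q [cp p0 dp] [cq q0 dq] t tT.
have tT' z : 0 < z < T -> 0 <= z <= T by move=> /andP[? ?]; rewrite !ltW.
have key (c : R) z : 0 < z < T -> is_derive z (1 : R)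
     (fun z => expR (c * z) * (p z - q z) ^+ 2)
     (expR (c * z) * (c * (p z - q z) ^+ 2 + 2 * (p z - q z) * (speed z (p z) - speed z
       (q z)))).
  move=> /tT' zT; have Hp := dp z zT; have Hq := dq z zT.
  eapply is_derive_eq; [der ltac:(first [exact: Hp | exact: Hq]) | rewrite /=; ring].
have cE (c : R) : continuous (fun z : R => expR (c * z)).
  apply: (@der_continuous R _ (fun z => expR (c * z) * c)) => z.
  by eapply is_derive_eq; [der fail | rewrite /=; ring].
have lip z : `|2 * (p z - q z) * (speed z (p z) - speed z (q z))| <= 2 * L * (p z - q
  z) ^+ 2.
  rewrite normrM normrM (ger0_norm (_ : 0 <= 2)) // -(real_normK (num_real (p z - q z))).
  have := ler_wpM2l (normr_ge0 (p z - q z)) (HL z (p z) (q z)); rewrite expr2; lra.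
have cc (c : R) : continuous (fun z => expR (c * z) * (p z - q z) ^+ 2).
  by have := cE c => ?; cont.
split.
  have h : (expR (- (2 * L) * 0) * (p 0 - q 0) ^+ 2) >=
           (expR (- (2 * L) * t) * (p t - q t) ^+ 2).
    rewrite -lerN2.
    apply: (@der_nondecreasing R (fun z => - (expR (- (2 * L) * z) * (p z - q z) ^+ 2)) _ T
       (contN (cc _)) (fun z zT => derN (key _ z zT)) _ t tT).
    move=> z zT; rewrite oppr_ge0 pmulr_rle0 ?expR_gt0 //.
    by have := lip z; rewrite ler_norml => /andP[_]; lra.
  move: h; rewrite mulr0 expR0 mul1r p0 q0 mulNr expRN => h.
  have h2 : (p t - q t) ^+ 2 <= (expR (L * t) * (x - y)) ^+ 2.
    have E2 : expR (L * t) ^+ 2 = expR (2 * L * t).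
      by rewrite expr2 -expRD; congr expR; ring.
    by rewrite exprMn E2 -ler_pdivrMl ?expR_gt0.
  have h3 : `|p t - q t| <= expR (L * t) * `|x - y|.
    by rewrite -[expR _]ger0_norm ?expR_ge0 // -normrM -ler_sqr ?nnegrE // !real_normK
      ?num_real.
  apply: le_trans h3 _; rewrite ler_wpM2r // ler_expR ler_wpM2l ?(ltW L0) //.
  by case/andP: tT.
move=> xy; have h : expR (2 * L * 0) * (p 0 - q 0) ^+ 2 <=
                    expR (2 * L * t) * (p t - q t) ^+ 2.
  apply: (@der_nondecreasing R (fun z => expR (2 * L * z) * (p z - q z) ^+ 2) _ T
     (cc _) (fun z zT => key _ z zT) _ t tT).
  move=> z zT; rewrite pmulr_rge0 ?expR_gt0 //.
  by have := lip z; rewrite ler_norml => /andP[h _]; lra.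
apply/negP => /eqP pq; move: h; rewrite mulr0 expR0 mul1r p0 q0 pq subrr expr0n mulr0.
have : 0 < (x - y) ^+ 2 by rewrite exprn_even_gt0 //= subr_eq0.
lra.
Qed.

Section AlongCharacteristic.
Context (x0 : R) (q : R -> R).
Hypothesis Hq : characteristic x0 q.
Let cq : continuous q. Proof. by case: Hq. Qed.

(** The increment is split into a time increment at the displaced point [p t'] and a space increment
    at the fixed time [t]. The first needs a remainder uniform in x, because the point moves with
    t'. *)
Lemma der_W_along t x p : 0 < t < T -> characteristic x p ->
  is_derive t (1 : R) (fun t => W t (p t)) (source t (p t)).
Proof.
move=> tT [cp p0 dp]; have tT' : 0 <= t <= T by case/andP: tT => *; rewrite !ltW.
pose V y := source t y - speed t y * Z t y.
have cV : continuous V.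
  have c1 := der_continuous (der_source t); have c2 := der_continuous (der_speed t).
  have c3 : continuous (Z t).
    by move=> y; apply/cvgrPdist_le => e e0;
      have /cvgrPdist_le /(_ e e0) [[A B] /= [nA nB] HAB] := @jZ ((t : R), (y : R));
      apply: filterS nB => y' By; exact: (HAB (t, y') (conj (nbhs_singleton nA) By)).
  by rewrite /V; cont.
have /is_deriveP D3 := der_comp (dW t (p t)) (dp t tT').
apply/is_deriveP => e e0; have e3 : 0 < e / 3 by rewrite divr_gt0.
have [d1 d10 H1] := Wt tT e3; have [d3 d30 H3] := D3 _ e3.
have cVp : continuous (fun z => V (p z)) by apply: cont_comp.
have /cvgrPdist_le /(_ _ e3) /nbhs_ballP [d2 /= d20 H2] := cVp t.
exists (Num.min d1 (Num.min d2 d3)); first by rewrite !lt_min d10 d20 d30.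
move=> t'; rewrite !lt_min => /and3P[h1 h2 h3].
have a1 := H1 t' h1 (p t'); have a3 := H3 t' h3.
have a2 : `|V (p t) - V (p t')| <= e / 3 by apply: H2; rewrite /ball /= distrC.
have -> : W t' (p t') - W t (p t) - source t (p t) * (t' - t) =
   (W t' (p t') - W t (p t') - (t' - t) * V (p t')) +
   ((V (p t') - V (p t)) * (t' - t)) +
   (W t (p t') - W t (p t) - Z t (p t) * speed t (p t) * (t' - t)).
  by rewrite /V; ring.
apply: le_trans (ler_normD _ _) _; apply: le_trans (lerD (ler_normD _ _) (lexx _)) _.
have a4 : `|(V (p t') - V (p t)) * (t' - t)| <= e / 3 * `|t' - t|.
  by rewrite normrM ler_wpM2r // distrC.
lra.
Qed.

(* The difference quotient r = (W(p) - W(q)) / (p - q) along two nearby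
   characteristics satisfies r' = (quotient of source) - (quotient of speed) r;
   letting p tend to q avoids differentiating the flow, Z being only
   continuous. *)
Lemma der_Z_along t : 0 < t < T ->
  is_derive t (1 : R) (fun t => Z t (q t))
    (source_x t (q t) - speed_x t (q t) * Z t (q t)).
Proof.
move=> tT; have tT' z : 0 < z < T -> 0 <= z <= T by case/andP => *; rewrite !ltW.
have [K K0 HK] := characteristic_gap.
have [BA HBA] := bounded_speed_x; have [BZ HBZ] := bZ.
have BA0 : 0 <= BA by apply: le_trans (HBA 0 0).
have BZ0 : 0 <= BZ by apply: le_trans (HBZ 0 0).
have joint (f : R -> R -> R) (z e : R) : continuous (fun p : R * R => f p.1 p.2) ->
    0 < e -> exists2 d : R, 0 < d & forall t' x', `|t' - z| < d -> `|x' - q z| < d ->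
      `|f t' x' - f z (q z)| <= e.
  move=> cf e0; have /cvgrPdist_le /(_ e e0) /nbhs_ballP [d /= d0 Hd] := cf (z, q z).
  exists d => // t' x' h1 h2; rewrite distrC; apply: (Hd (t', x')).
  by split; rewrite /ball /= distrC.
pose H0 := source_x t (q t) - speed_x t (q t) * Z t (q t).
apply/is_deriveP => e e0.
(* The three errors in the derivative of the quotient are at most e1, e1 BZ and e1 BA, which add up
   to [e]. *)
pose e1 := e / (1 + BA + BZ).
have S0 : 0 < 1 + BA + BZ by lra.
have e10 : 0 < e1 by rewrite divr_gt0.
have [d1 d10 H1] := joint _ t _ joint_source_x e10.
have [d2 d20 H2] := joint _ t _ joint_speed_x e10.
have [d3 d30 H3] := joint _ t _ jZ e10.
have [d [d0 dd1 dd2 dd3]] : exists d : R, [/\ 0 < d, d <= d1, d <= d2 & d <= d3].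
  exists (Num.min d1 (Num.min d2 d3)).
  by rewrite !lt_min d10 d20 d30 !ge_min !lexx !orbT.
have d20' : 0 < d / 2 by rewrite divr_gt0.
have /cvgrPdist_lt /(_ _ d20') /nbhs_ballP [d4 /= d40 H4] := @cq t.
have /andP[t0 tT1] := tT.
exists (Num.min (Num.min d d4) (Num.min t (T - t))).
  by rewrite !lt_min d0 d40 t0 subr_gt0.
move=> t'; rewrite !lt_min => /andP[/andP[t'd t'd4] /andP[t't t'T]].
have mid z : Num.min t t' <= z <= Num.max t t' ->
    [/\ 0 < z < T, `|z - t| < d & `|z - t| < d4].
  move=> zz; have hz : `|z - t| <= `|t' - t|.
    move: zz; case: (leP t t') => h /andP[z1 z2].
      by rewrite !ger0_norm ?subr_ge0 // lerD2r.
    by rewrite !ler0_norm ?subr_le0 ?(ltW h) //; lra.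
  have hz' := le_lt_trans hz t't; have hz'' := le_lt_trans hz t'T.
  split; [|exact: le_lt_trans t'd|exact: le_lt_trans t'd4].
  by move: hz' hz''; rewrite !ltr_norml => /andP[? ?] /andP[? ?]; apply/andP; split; lra.
have t'0T : 0 < t' < T.
  by have [] := mid t'; rewrite // ge_min le_max lexx !orbT.
have quot (f fx : R -> R -> R) z (p1 p2 : R) : (forall x, is_derive x (1 : R) (f z) (fx
  z x)) ->
    p1 != p2 -> exists2 c, `|c - p2| <= `|p1 - p2| & (f z p1 - f z p2) / (p1 - p2) = fx z c.
  move=> D ne; have [c hc ->] := MVT_all p2 p1 D; exists c => //.
  by rewrite mulfK // subr_eq0.
(* The radius is already fixed, while the neighbouring characteristic may still depend on t' and
   [eta]. Replacing u_xx by the quotient costs at most [eta] at each of the two times. *)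
suff approx (eta : R) : 0 < eta ->
   `|Z t' (q t') - Z t (q t) - H0 * (t' - t)| <= e * `|t' - t| + 2 * eta.
  apply/ler_addgt0Pl => eta eta0.
  have eta2 : 0 < eta / 2 by rewrite divr_gt0.
  have := approx _ eta2; lra.
move=> eta0.
have [d5 d50 H5] := joint _ t' _ jZ eta0; have [d6 d60 H6] := joint _ t _ jZ eta0.
(* The initial separation: the gap stays at most K h, half of the allowed distance and hence
   strictly below it. *)
pose h := Num.min (d / 2) (Num.min d5 d6) / (2 * K).
have K20 : 0 < 2 * K by rewrite mulr_gt0.
have h0 : 0 < h by rewrite divr_gt0 // !lt_min d20' d50 d60.
have [p Hp] := characteristic_exists (x0 + h).
have gap z : 0 < z < T -> `|p z - q z| < Num.min (d / 2) (Num.min d5 d6) /\ p z != q z.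
  move=> /tT' zT; have [g1 g2] := HK _ _ _ _ Hp Hq z zT.
  split; last by apply: g2; rewrite addrC -subr_eq0 addrK gt_eqF.
  apply: le_lt_trans g1 _; rewrite addrC addKr ger0_norm ?(ltW h0) //.
  have -> : Num.min (d / 2) (Num.min d5 d6) = 2 * (K * h).
    by rewrite mulrA [RHS]mulrC /h divfK // gt_eqF.
  by have := mulr_gt0 K0 h0; lra.
pose r z := (W z (p z) - W z (q z)) / (p z - q z).
pose dr z := (source z (p z) - source z (q z)) / (p z - q z) -
  (speed z (p z) - speed z (q z)) / (p z - q z) * r z.
have Dr z : 0 < z < T -> is_derive z (1 : R) r (dr z).
  move=> zT; have zT' := tT' z zT; have [_ pq] := gap z zT.
  have [_ _ dp] := Hp; have [_ _ dq] := Hq.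
  have pq0 : p z - q z != 0 by rewrite subr_eq0.
  have D1 := derD (der_W_along zT Hp) (derN (der_W_along zT Hq)).
  have D2 := @derV R (fun y => p y - q y) z _ pq0 (derD (dp z zT') (derN (dq z zT'))).
  apply: (is_derive_eq (derM D1 D2)); by rewrite /dr /r /=; field.
have rZ z : 0 < z < T -> exists2 c, `|c - q z| < Num.min (d / 2) (Num.min d5 d6) & r z
  = Z z c.
  move=> zT; have [g1 g2] := gap z zT.
  have [c hc Ec] := quot W Z z (p z) (q z) (dW z) g2.
  by exists c => //; exact: le_lt_trans hc g1.
have drH z : Num.min t t' <= z <= Num.max t t' -> `|dr z - H0| <= e.
  move=> /mid [zT ztd ztd4]; have [g1 g2] := gap z zT.
  have near c : `|c - q z| < d / 2 -> `|c - q t| < d.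
    move=> hc; have : `|q t - q z| < d / 2 by apply: H4; rewrite /ball /= distrC.
    have := ler_distD (q z) c (q t); rewrite (distrC (q z) (q t)); lra.
  have lt1 (b : R) : b < Num.min (d / 2) (Num.min d5 d6) -> b < d / 2.
    by rewrite lt_min => /andP[].
  have [c1 hc1 E1] := quot source source_x z (p z) (q z) (der_source z) g2.
  have [c2 hc2 E2] := quot speed speed_x z (p z) (q z) (der_speed z) g2.
  have [c3 hc3 E3] := rZ z zT.
  have n1 := near _ (lt1 _ (le_lt_trans hc1 g1)).
  have n2 := near _ (lt1 _ (le_lt_trans hc2 g1)).
  have n3 := near _ (lt1 _ hc3).
  rewrite /dr E1 E2 E3.
  have a1 := H1 z c1 (lt_le_trans ztd dd1) (lt_le_trans n1 dd1).
  have a2 := H2 z c2 (lt_le_trans ztd dd2) (lt_le_trans n2 dd2).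
  have a3 := H3 z c3 (lt_le_trans ztd dd3) (lt_le_trans n3 dd3).
  have -> : source_x z c1 - speed_x z c2 * Z z c3 - H0 =
     (source_x z c1 - source_x t (q t)) - ((speed_x z c2 - speed_x t (q t)) * Z z c3 +
       speed_x t (q t) * (Z z c3 - Z t (q t))) by rewrite /H0; ring.
  apply: le_trans (ler_normB _ _) _.
  apply: le_trans (lerD (lexx _) (ler_normD _ _)) _.
  rewrite (normrM (_ - _) (Z z c3)) (normrM (speed_x t (q t))).
  have b1 := ler_pM (normr_ge0 _) (normr_ge0 _) a2 (HBZ z c3).
  have b2 := ler_pM (normr_ge0 _) (normr_ge0 _) (HBA t (q t)) a3.
  have -> : e = e1 * (1 + BA + BZ) by rewrite /e1 divfK // gt_eqF.
  lra.
have [c hc Ec] := MVT_between (fun z zz => let: And3 zT _ _ := mid z zz in Dr z zT).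
have b1 : `|r t' - r t - H0 * (t' - t)| <= e * `|t' - t|.
  by rewrite Ec -mulrBl normrM ler_wpM2r // drH.
have b2 : `|r t' - Z t' (q t')| <= eta.
  have [c1 hc1 ->] := rZ t' t'0T; apply: H5; first by rewrite subrr normr0.
  by move: hc1; rewrite !lt_min => /and3P[].
have b3 : `|r t - Z t (q t)| <= eta.
  have [c1 hc1 ->] := rZ t tT; apply: H6; first by rewrite subrr normr0.
  by move: hc1; rewrite !lt_min => /and3P[].
have -> : Z t' (q t') - Z t (q t) - H0 * (t' - t) =
  (r t' - r t - H0 * (t' - t)) - (r t' - Z t' (q t')) + (r t - Z t (q t)) by ring.
apply: le_trans (ler_normD _ _) _; apply: le_trans (lerD (ler_normB _ _) (lexx _)) _.
lra.
Qed.

End AlongCharacteristic.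
End Characteristics.

(** * Blow-up *)

Section BlowUp.
Context {R : realType} (k1 k2 mu E T : R) (U W Z : R -> R -> R).
Hypothesis T0 : 0 < T.
Hypothesis dU : forall t x, is_derive x (1 : R) (U t) (W t x).
Hypothesis dW : forall t x, is_derive x (1 : R) (W t) (Z t x).
Hypothesis jU : continuous (fun p : R * R => U p.1 p.2).
Hypothesis jW : continuous (fun p : R * R => W p.1 p.2).
Hypothesis jZ : continuous (fun p : R * R => Z p.1 p.2).
Hypothesis bU : bounded2 U.
Hypothesis bW : bounded2 W.
Hypothesis bZ : bounded2 Z.
Hypothesis Wt : forall t, 0 < t < T ->
  forall e : R, 0 < e -> exists2 d : R, 0 < d & forall t' : R, `|t' - t| < d ->
    forall x, `|W t' x - W t x - (t' - t) *
      (source k1 k2 mu E U W t x - speed k1 k2 mu U W t x * Z t x)| <= e * `|t' - t|.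
Hypothesis k10 : 0 < k1.
Hypothesis k20 : 0 < k2.
Hypothesis E0 : 0 <= E.
Hypothesis osc : forall t x, 0 <= t <= T -> U t x - mu <= Num.sqrt 3 / 6 * Num.sqrt E.

Let mu1 := Num.sqrt E.
Let C2 := k1 * mu * mu1 * (Num.sqrt 3 / 3 * mu - mu1)
            + k2 * mu1 * (Num.sqrt 3 / 3 * mu - mu1 / 2).
Hypothesis C10 : 3 / 2 * k2 - k1 * mu <= 0.

Let mu_gt0 : 0 < mu.
Proof. by rewrite -(pmulr_rgt0 mu k10); move: C10 k20; lra. Qed.

(** C2 is the value of the source with u_x = 0 and with u - mu at the maximum allowed by the
    oscillation bound. C1 <= 0 says k1 mu + k2 / 2 >= 2 k2, which bounds the coefficient of
    u_x^2. *)
Lemma source_le t x : 0 <= t <= T ->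
  source k1 k2 mu E U W t x <= C2 - 2 * k2 * W t x ^+ 2.
Proof.
move=> tT; have EE : E = mu1 ^+ 2 by rewrite sqr_sqrtr.
have h0 : 0 <= 2 * k1 * mu ^+ 2 + 2 * k2 * mu.
  by rewrite addr_ge0 // !mulr_ge0 ?sqr_ge0 // ltW.
have h1 := ler_wpM2l h0 (osc x tT); rewrite -/mu1 in h1.
have h2 : 2 * k2 * W t x ^+ 2 <= (k1 * mu + 2^-1 * k2) * W t x ^+ 2.
  by rewrite ler_wpM2r ?sqr_ge0 //; move: C10; lra.
rewrite /source /C2 EE; move: h1 h2; rewrite !expr2; lra.
Qed.

(** The hyperbolic bound at time T combined with y(T) > k1: here b y'(0) = c y0, and multiplying by
    X = exp (T / b) turns cosh and sinh into a quadratic polynomial. *)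
Lemma momentum_growth (b x0 y0 c X : R) : 0 < b -> 2 * k2 * C2 * b ^+ 2 = 1 ->
  0 < mu - Z 0 x0 -> y0 = k1 + k2 / (mu - Z 0 x0) ->
  c = 2 * b * k2 * W 0 x0 -> X = expR (T / b) ->
  k1 * X < y0 / 2 * ((c + 1) * X ^+ 2 + (1 - c)).
Proof.
move=> b0 bC m00 y0E cE X_E.
have [q Hq] := characteristic_exists k1 k2 mu T0 dU dW jU jW bU bW bZ x0.
have [cq q0 dq] := Hq.
pose w t := W t (q t); pose m t := mu - Z t (q t).
have cw : continuous w := joint_comp jW cq.
have cz : continuous (fun t => Z t (q t)) := joint_comp jZ cq.
have cm : continuous m by rewrite /m; cont.
have dm t : 0 < t < T -> is_derive t (1 : R) m (- (2 * w t * m t * (k1 * m t + k2))).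
  move=> tT.
  have D := der_Z_along T0 dU dW jU jW jZ bU bW bZ Wt Hq tT.
  apply: (is_derive_eq (derD (der_cst mu t) (derN D))).
  by rewrite /source_x /speed_x /m /w; ring.
have dw t : 0 < t < T -> is_derive t (1 : R) w (source k1 k2 mu E U W t (q t)).
  by move=> tT; exact: (der_W_along dU dW jZ Wt tT Hq).
(* Read with this coefficient, the equation for m is linear, m' = g m, so m is m(0) times an
   exponential and stays positive. *)
pose g t := - (2 * w t * (k1 * m t + k2)).
have cg : continuous g by rewrite /g; cont.
have [Phi [Phi0 dPhi]] := primitive_exists cg.
have cPhi := der_continuous dPhi.
have cexp (f : R -> R) : continuous f -> continuous (fun t => expR (f t)).
  by apply: cont_comp => x; exact: continuous_expR.
have cNPhi : continuous (fun t => - Phi t) by cont.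
have ceN := cexp _ cNPhi.
have tT' z : 0 < z < T -> 0 <= z <= T by case/andP => *; rewrite !ltW.
have mE t : 0 <= t <= T -> m t * expR (- Phi t) = m 0.
  have D z : 0 < z < T -> is_derive z (1 : R) (fun t => m t * expR (- Phi t)) 0.
    move=> zT; apply: (is_derive_eq (derM (dm z zT) (der_expR (derN (dPhi z))))).
    by rewrite /g; ring.
  have c1 : continuous (fun t => m t * expR (- Phi t)) by cont.
  move=> tT; apply/eqP; rewrite eq_le; apply/andP; split.
    rewrite -lerN2.
    have := der_nondecreasing (contN c1) (fun z zT => derN (D z zT)) _ tT.
    by rewrite Phi0 oppr0 expR0 mulr1; apply => z _; rewrite ?oppr0.
  have := der_nondecreasing c1 (fun z zT => D z zT) _ tT.
  by rewrite Phi0 oppr0 expR0 mulr1; apply.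
have m0E : m 0 = mu - Z 0 x0 by rewrite /m q0.
(* Equal to k1 + k2 / m on [0, T]; with the exponential in place of 1 / m, continuity and y > k1
   hold at every time. *)
pose y t := k1 + k2 / m 0 * expR (- Phi t).
have cy : continuous y by rewrite /y; cont.
have m0n : m 0 != 0 by rewrite m0E gt_eqF.
have y00 : y 0 = y0 by rewrite /y Phi0 oppr0 expR0 mulr1 m0E y0E.
have yk t : k1 < y t.
  by rewrite /y ltrDl mulr_gt0 ?expR_gt0 // divr_gt0 // m0E.
have dy t : 0 < t < T -> is_derive t (1 : R) y (2 * k2 * w t * y t).
  move=> tT; have D := derD (der_cst k1 t)
    (derM (der_cst (k2 / m 0) t) (der_expR (derN (dPhi t)))).
  apply: (is_derive_eq D).
  have me := mE t (tT' t tT).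
  have -> : 0 + (0 * expR (- Phi t) + k2 / m 0 * (expR (- Phi t) * - g t)) =
    2 * k2 * w t * (k1 * (m t * expR (- Phi t)) / m 0 + k2 / m 0 * expR (- Phi t)).
    by rewrite /g; field.
  by rewrite me /y mulfK.
pose be := b^-1.
have be0 : 0 < be by rewrite invr_gt0.
have beC : 2 * k2 * C2 = be ^+ 2.
  have b2 : b ^+ 2 != 0 by rewrite expf_neq0 ?gt_eqF.
  by apply: (mulIf b2); rewrite bC /be exprVn mulVf.
(* This is exp (t / b) (y' - y / b); its derivative is exp (t / b) (y'' - y / b^2). *)
pose p t := expR (be * t) * (y t * (2 * k2 * w t - be)).
have dlin (a t : R) : is_derive t (1 : R) (fun t => a * t) a.
  by apply: (is_derive_eq (derM (der_cst a t) (der_id t))); rewrite mul0r add0r mulr1.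
have clin (a : R) : continuous (fun t : R => a * t) by cont.
have ce1 := cexp _ (clin be).
have cp : continuous p by rewrite /p; cont.
have dp t : 0 < t < T -> is_derive t (1 : R) p (expR (be * t) * (y t *
    ((2 * k2 * w t) ^+ 2 - be ^+ 2 + 2 * k2 * source k1 k2 mu E U W t (q t)))).
  move=> tT; have D := derM (der_expR (dlin be t)) (derM (dy t tT)
    (derD (derM (der_cst (2 * k2) t) (dw t tT)) (der_cst (- be) t))).
  by apply: (is_derive_eq D); ring.
have pp0 t : 0 <= t <= T -> p t <= p 0.
  move=> tT; rewrite -lerN2.
  have := der_nondecreasing (contN cp) (fun z zT => derN (dp z zT)) _ tT; apply.
  move=> z zT; rewrite oppr_ge0 pmulr_rle0 ?expR_gt0 // pmulr_rle0; last first.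
    by apply: lt_trans (yk z).
  have := ler_wpM2l (ltW k20) (source_le (q z) (tT' z zT)); rewrite -/(w z) -beC.
  rewrite !expr2; lra.
have ce2 := cexp _ (clin (- be)); have ce3 := cexp _ (clin (- (2 * be))).
(* Integrates p <= p(0) once more: exp (- t / b) y has derivative exp (- 2 t / b) p, and the second
   term is a primitive of the bound with p(0), up to sign. *)
pose r t := - (expR (- be * t) * y t + p 0 / (2 * be) * expR (- (2 * be) * t)).
have cr : continuous r by rewrite /r; cont.
have e3E t : expR (- (2 * be) * t) = expR (- be * t) ^+ 2.
  by rewrite expr2 -expRD; congr expR; ring.
have e2E t : expR (be * t) * expR (- be * t) = 1.
  by rewrite -expRD -expR0; congr expR; ring.
have dr t : 0 < t < T -> is_derive t (1 : R) r (expR (- be * t) ^+ 2 * (p 0 - p t)).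
  move=> tT; have D := derN (derD (derM (der_expR (dlin (- be) t)) (dy t tT))
    (derM (der_cst (p 0 / (2 * be)) t) (der_expR (dlin (- (2 * be)) t)))).
  apply: (is_derive_eq D); rewrite e3E.
  have -> : expR (- be * t) ^+ 2 * (p 0 - p t) = expR (- be * t) ^+ 2 * p 0 -
     expR (- be * t) * (expR (be * t) * expR (- be * t)) * (y t * (2 * k2 * w t - be)).
    by rewrite /p; ring.
  rewrite e2E; field; rewrite gt_eqF //.
have TT : 0 <= T <= T by rewrite lexx ltW.
have rr : r 0 <= r T.
  have := der_nondecreasing cr dr _ TT; apply => z zT.
  by rewrite mulr_ge0 ?sqr_ge0 // subr_ge0 pp0 // tT'.
have XE : expR (- be * T) = X^-1.
  by rewrite X_E /be mulNr expRN mulrC.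
have X0 : 0 < X by rewrite X_E expR_gt0.
have p0E : p 0 / (2 * be) = y0 * (c - 1) / 2.
  rewrite /p mulr0 expR0 mul1r y00 /w q0 cE /be; field; rewrite gt_eqF //.
move: rr; rewrite /r !e3E !XE p0E !mulr0 expR0 expr1n y00 lerN2 => rr.
have X2 : 0 < X ^+ 2 by rewrite exprn_gt0.
have := ler_wpM2l (ltW X2) rr.
have -> : X ^+ 2 * (X^-1 * y T + y0 * (c - 1) / 2 * X^-1 ^+ 2) =
   X * y T + y0 * (c - 1) / 2 by field; rewrite gt_eqF.
have := ltr_pM2l X0 k1 (y T); rewrite yk; lra.
Qed.

End BlowUp.

(** Feeds the fields frozen outside [0, T] to the abstract argument. The conserved quantities,
    computed from the initial datum, become its constants mu and E. *)
Lemma strong_solution_growth (R : realType) (k1 k2 s T : R) (u0 : R -> R)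
    (Tmax : \bar R) (u : R -> R -> R) (b x0 y0 c X : R) :
  let mu0 := mean u0 in
  let mu1 := Num.sqrt (mean (fun x => derive1 u0 x ^+ 2)) in
  let C2 := k1 * mu0 * mu1 * (Num.sqrt 3 / 3 * mu0 - mu1)
            + k2 * mu1 * (Num.sqrt 3 / 3 * mu0 - mu1 / 2) in
  5 / 2 < s -> 0 < T -> (T%:E < Tmax)%E ->
  strong_solution k1 k2 s u0 Tmax u -> 0 < k1 -> 0 < k2 ->
  3 / 2 * k2 - k1 * mu0 <= 0 -> 0 < b -> 2 * k2 * C2 * b ^+ 2 = 1 ->
  0 < momentum u0 x0 -> y0 = k1 + k2 / momentum u0 x0 ->
  c = 2 * b * k2 * derive1 u0 x0 -> X = expR (T / b) ->
  (k1 * X < y0 / 2 * ((c + 1) * X ^+ 2 + (1 - c)))%R.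
Proof.
move=> mu0 mu1 C2 s52 T0 TT su k10 k20 C10 b0 bC m00 y0E cE XE.
have [jU jW jZ] := joint_regularity s52 T0 TT su.
have dU t := let: And4 d _ _ _ := space_regularity s52 T0 TT su t in d.
have dW t := let: And4 _ d _ _ := space_regularity s52 T0 TT su t in d.
have [B HB] := fields_bounded s52 T0 TT su.
have bU : bounded2 (clamped_u T u) by exists B => t x; have [] := HB t x.
have bW : bounded2 (clamped_ux T u) by exists B => t x; have [] := HB t x.
have bZ : bounded2 (clamped_uxx T u) by exists B => t x; have [] := HB t x.
have osc t x := @oscillation R k1 k2 s T u0 Tmax u s52 T0 TT su t x.
have U0 : clamped_u T u 0 = u0.
  by rewrite /clamped_u clamp_id ?lexx ?ltW //; have [-> _] := su.
set E := mean (fun x => derive1 u0 x ^+ 2) in osc.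
have E0 : 0 <= E by apply: Rintegral_ge0 => x _; exact: sqr_ge0.
have mE : momentum u0 x0 = mu0 - clamped_uxx T u 0 x0.
  by rewrite /momentum /clamped_uxx U0.
rewrite mE in m00 y0E.
rewrite -U0 -/(clamped_ux T u 0) in cE.
apply: (momentum_growth T0 dU dW jU jW jZ bU bW bZ _ k10 k20 E0 osc C10 b0 bC m00 y0E
  cE XE).
move=> t tT e e0.
have [d d0 Hd] := @gradient_time_derivative R k1 k2 s T u0 Tmax u s52 T0 TT su t tT e e0.
exists d => // t' tt' x; have := Hd t' tt' x; rewrite -/E -/mu0.
suff -> : source k1 k2 mu0 E (clamped_u T u) (clamped_ux T u) t x -
   speed k1 k2 mu0 (clamped_u T u) (clamped_ux T u) t x * clamped_uxx T u t x =
   (k1 * ((2 * mu0 * clamped_u T u t x - clamped_ux T u t x ^+ 2) * (mu0 - clamped_uxx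
     T u t x))
        + k2 * (clamped_u T u t x * (mu0 - clamped_uxx T u t x) + mu0 * clamped_u T u t
          x - 2^-1 * clamped_ux T u t x ^+ 2)
        - (k1 * (2 * mu0 ^+ 3 + mu0 * E) + k2 * (2 * mu0 ^+ 2 + 2^-1 * E))) by [].
by rewrite /source /speed; field.
Qed.

(** * The explicit blow-up time *)

Unset Implicit Arguments.

Theorem theorem7p2 (R : realType) (k1 k2 s : R) (u0 : R -> R)
    (Tmax : \bar R) (u : R -> R -> R) (x0 : R) :
  let mu0 := mean u0 in
  let mu1 := Num.sqrt (mean (fun x => derive1 u0 x ^+ 2)) in
  let m0 := momentum u0 in
  let C1 := 3 / 2 * k2 - k1 * mu0 in
  let C2 := k1 * mu0 * mu1 * (Num.sqrt 3 / 3 * mu0 - mu1)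
            + k2 * mu1 * (Num.sqrt 3 / 3 * mu0 - mu1 / 2) in
  let b := Num.sqrt (1 / (2 * k2 * C2)) in
  let n0 := 1 / m0 x0 in
  let n1 := 2 * b * (k1 + k2 / m0 x0) * derive1 u0 x0 in
  let case1 := derive1 u0 x0 = - (1 / (2 * b * k2)) in
  let case2 :=
    derive1 u0 x0 < Num.min (- (1 / (2 * b * k2)))
      (- (Num.sqrt (k2 + 2 * k1 * m0 x0)
          / (2 * b * Num.sqrt k2 * (k1 * m0 x0 + k2)))) in
  let tstar1 := Num.sqrt (1 / (2 * k2 * C2)) * ln (k2 / (k1 * m0 x0) + 1) in
  let tstar2 := Num.sqrt (1 / (2 * k2 * C2)) *
    ln ((k1 / k2 - Num.sqrt (n1 ^+ 2 - n0 ^+ 2 - 2 * (k1 / k2) * n0))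
        / (n0 + n1 + k1 / k2)) in
  0 < k1 -> 0 < k2 -> 5 / 2 < s -> sobolev s u0 ->
  C1 <= 0 -> 0 < C2 ->
  (0 < Tmax)%E -> maximal_strong_solution k1 k2 s u0 Tmax u ->
  (forall x, 0 <= m0 x) -> 0 < m0 x0 ->
  case1 \/ case2 ->
  [/\ (Tmax < +oo)%E,
      case1 -> (Tmax <= tstar1%:E)%E
    & case2 -> (Tmax <= tstar2%:E)%E].
Proof.
move=> mu0 mu1 m0 C1 C2 b n0 n1 case1 case2 tstar1 tstar2.
move=> k10 k20 s52 _ C10 C20 _ [su _] _ m00 cases.
have C210 : 0 < 1 / (2 * k2 * C2) by rewrite divr_gt0 // !mulr_gt0.
have b0 : 0 < b by rewrite sqrtr_gt0.
have bC : 2 * k2 * C2 * b ^+ 2 = 1.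
  by rewrite sqr_sqrtr ?(ltW C210) // mul1r mulfV // gt_eqF // !mulr_gt0.
have grow (T : R) (T0 : 0 < T) (TT : (T%:E < Tmax)%E) :=
  @strong_solution_growth R k1 k2 s T u0 Tmax u b x0 _ _ _ s52 T0 TT su k10 k20 C10 b0 bC m00 erefl erefl erefl.
pose w0 := derive1 u0 x0.
pose y0 := k1 + k2 / m0 x0.
have y00 : 0 < y0 by rewrite addr_gt0 // divr_gt0.
have bk : 0 < 2 * b * k2 by rewrite !mulr_gt0.
have concl1 : case1 -> (Tmax <= tstar1%:E)%E.
  rewrite /case1 -/w0 => w0E; rewrite leNgt; apply/negP => TT.
  have X1 : 1 < k2 / (k1 * m0 x0) + 1.
    by rewrite ltrDr divr_gt0 // mulr_gt0.
  have T0 : 0 < tstar1 by rewrite mulr_gt0 // ln_gt0.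
  have := grow _ T0 TT; rewrite -/m0 -/y0 -/w0.
  have -> : tstar1 / b = ln (k2 / (k1 * m0 x0) + 1).
    by rewrite /tstar1 -/b mulrC mulKf // gt_eqF.
  rewrite lnK ?posrE; last by apply: lt_trans X1.
  (* At c = -1 the growth inequality reduces to k1 X < y0, while t* is the time at which k1 X =
     y0. *)
  have -> : 2 * b * k2 * w0 = -1.
    by rewrite w0E mulrN mul1r mulfV // gt_eqF.
  have -> : k1 * (k2 / (k1 * m0 x0) + 1) = y0.
    by rewrite /y0; field; rewrite !gt_eqF.
  lra.
have concl2 : case2 -> (Tmax <= tstar2%:E)%E.
  rewrite /case2 -/w0 lt_min => /andP[w0lt _]; rewrite leNgt; apply/negP => TT.
  pose ka := k1 / k2; pose S := n0 + n1 + ka.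
  pose D := n1 ^+ 2 - n0 ^+ 2 - 2 * ka * n0.
  (* A root of S X^2 - 2 ka X + (n0 + ka - n1), whose reduced discriminant is D. Since c < -1, S is
     negative and the constant term positive, so this is the only positive root. *)
  pose X := (ka - Num.sqrt D) / S.
  have ka0 : 0 < ka by rewrite divr_gt0.
  have n00 : 0 < n0 by rewrite divr_gt0.
  pose c := 2 * b * k2 * w0.
  have c1 : c < -1.
    have : c < 2 * b * k2 * - (1 / (2 * b * k2)) by rewrite /c ltr_pM2l.
    by rewrite mulrN mul1r mulfV // gt_eqF.
  have y0E : y0 = k2 * (n0 + ka) by rewrite /y0 /n0 /ka; field; rewrite !gt_eqF.
  have n1E : n1 = (n0 + ka) * c.
    by rewrite /n1 /n0 /ka /c -/w0; field; rewrite !gt_eqF.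
  have nk : 0 < n0 + ka by rewrite addr_gt0.
  have S0 : S < 0.
    have -> : S = (n0 + ka) * (1 + c) by rewrite /S n1E; ring.
    by rewrite pmulr_rlt0 //; lra.
  have D0 : ka ^+ 2 < D.
    have : 0 < (n0 + ka) ^+ 2 * (c ^+ 2 - 1).
      by rewrite mulr_gt0 ?exprn_gt0 //; nra.
    by rewrite /D n1E; nra.
  have D00 : 0 <= D by apply: le_trans (ltW D0); exact: sqr_ge0.
  have sD : Num.sqrt D ^+ 2 = D by rewrite sqr_sqrtr.
  have sk : ka < Num.sqrt D.
    by rewrite -(ger0_norm (ltW ka0)) -sqrtr_sqr ltr_sqrt // (le_lt_trans (sqr_ge0 ka)).
  have X0 : 0 < X by rewrite /X nmulr_rgt0 ?subr_lt0 // invr_lt0.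
  have root : S * X ^+ 2 - 2 * ka * X + (n0 + ka - n1) = 0.
    have -> : S * X ^+ 2 - 2 * ka * X + (n0 + ka - n1) =
       (Num.sqrt D ^+ 2 - ka ^+ 2 + (n0 + ka - n1) * S) / S.
      by rewrite /X; field; rewrite lt_eqF.
    by rewrite sD /D /S; apply/eqP; rewrite mulf_eq0; apply/orP; left; apply/eqP; ring.
  (* Needed for t* > 0. On [0, 1] the polynomial is at least its value at 1 with the positive
     constant kept, namely 2 n0 > 0, so no root lies there. *)
  have X1 : 1 < X.
    rewrite ltNge; apply/negP => X1.
    have X2 : X ^+ 2 <= 1 by rewrite expr_le1 // ltW.
    have h1 : S <= S * X ^+ 2 by rewrite -[leLHS]mulr1 ler_wnM2l // ltW.
    have h2 : ka * X <= ka by rewrite -[leRHS]mulr1 ler_wpM2l // ltW.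
    move: root; rewrite /S in h1 *; lra.
  have T0 : 0 < tstar2 by rewrite mulr_gt0 // ln_gt0.
  have := grow _ T0 TT; rewrite -/m0 -/y0 -/w0 -/c.
  have -> : tstar2 / b = ln X.
    by rewrite /tstar2 -/b mulrC mulKf // gt_eqF.
  rewrite lnK ?posrE // => h.
  (* Twice the growth inequality: it makes the polynomial strictly positive at its own root. *)
  have : k2 * (2 * ka * X) < k2 * (S * X ^+ 2 + (n0 + ka - n1)).
    have -> : k2 * (2 * ka * X) = 2 * (k1 * X) by rewrite /ka; field; rewrite gt_eqF.
    have -> : k2 * (S * X ^+ 2 + (n0 + ka - n1)) =
       2 * (y0 / 2 * ((c + 1) * X ^+ 2 + (1 - c))).
      by rewrite y0E /S n1E; field.
    by rewrite ltr_pM2l.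
  rewrite ltr_pM2l //; move: root; lra.
split=> //.
by case: cases => [/concl1|/concl2] /le_lt_trans; apply; exact: ltry.
Qed.
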